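(* Let $\mathbf m_1,\mathbf m_2,\dots,\mathbf m_s$ be $s$ monomials in $S=\Bbbk[x_1,\dots,x_n]$ of the same degree $d$, such that $\mathbf m_1\succ_{rlex}\mathbf m_2\succ_{rlex}\dots\succ_{rlex}\mathbf m_s$, which minimally generate in the Borel sense an ideal $I=\langle\mathbf m_1,\dots,\mathbf m_s\rangle$. Then there exists a polyhedral cell complex $Q(\mathbf m_1,\dots,\mathbf m_s)$ that supports a minimal free resolution of $I$. Moreover, $Q(\mathbf m_1,\dots,\mathbf m_s)$ is the union of all the convex polytopes (faces) of the polyhedral cell complex $P_d(x_1,\dots,x_n)$ with (all) vertices in $I=\langle\mathbf m_1,\dots,\mathbf m_s\rangle$.
   Context: $\Bbbk$ is a field with $\operatorname{char}(\Bbbk)=0$, $S=\Bbbk[x_1,\dots,x_n]$. For a monomial ideal $I$, $G(I)$ denotes its unique minimal set of monomial generators. For a monomial $\mathbf m=x_1^{a_1}\cdots x_n^{a_n}$, $e(\mathbf m)=(a_1,\dots,a_n)$. For monomials of the same degree, $\mathbf m_1\succ_{rlex}\mathbf m_2$ means that the rightmost nonzero entry of $e(\mathbf m_1)-e(\mathbf m_2)$ is negative. A monomial ideal $I$ is Borel fixed if for every $\mathbf m\in G(I)$, every $x_t$ dividing $\mathbf m$ and every $1\le r<t$, the monomial $\frac{\mathbf m}{x_t}x_r$ is in $I$. $\langle\mathbf m_1,\dots,\mathbf m_s\rangle$ denotes the smallest Borel fixed ideal containing $\mathbf m_1,\dots,\mathbf m_s$; these monomials minimally generate it in the Borel sense if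 none of them can be omitted without changing this ideal. A polyhedral cell complex is a nonempty finite collection $X$ of convex polytopes (called faces) in some $\mathbb R^N$ such that every face of a polytope in $X$ is in $X$, and the intersection of any two polytopes in $X$ is a face of both. It is in particular a regular cell complex. Cellular resolutions: let $X$ be a regular cell complex whose vertices are labelled bijectively by the elements of $G(I)$. Each nonempty face $F$ is labelled by $\mathbf m_F$, the least common multiple of the labels of its vertices, and has degree $e(\mathbf m_F)$. Let $\epsilon_X$ be an incidence function on $X$ (with values $\pm1$ on pairs $(F,F')$ with $F'$ a codimension-one face of $F$, and $0$ otherwise). The cellular complex $\mathbf F_X$ is the $\mathbb Z^n$-graded free $S$-module $\bigoplus_{\varnothing\ne F\in X}SF$, with $F$ in degree $e(\mathbf m_F)$ and in homological degree $\dim F$, with differential $\partial F=\sum_{\varnothing\neq F'\in X}\epsilon_X(F,F')\frac{\mathbf m_F}{\mathbf m_{F'}}F'$. One says $X$ supports a (minimal) free resolution of $I$ if $\mathbf F_X$ is a (minimal) free resolution of $I$. The complex $P_d(x_1,\dots,x_n)$: for $1\le a\le b\le n$ let $\Delta(x_a,\dots,x_b)$ be the simplex with vertices the unit vectors of $\mathbb R^n$ indexed by $a,\dots,b$ (labelled $x_a,\dots,x_b$), with all its faces. Define recursively $P_1(x_a,\dots,x_b)=\Delta(x_a,\dots,x_b)$ and $$P_{d+1}(x_a,\dots,x_b)=\bigcup_{k=a}^{b}\Delta(x_a,\dots,x_k)\times P_d(x_k,\dots,x_b),$$ where a product cell $F\times G$ is realized in $\mathbb R^n$ as the Minkowski sum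 $F+G$, its vertex corresponding to a pair of vertices labelled $\mathbf u,\mathbf v$ being labelled $\mathbf u\mathbf v$ (so it is the point $e(\mathbf u\mathbf v)$). Thus $P_d(x_1,\dots,x_n)$ is a polyhedral cell complex subdividing the simplex with vertices $e(x_1^d),\dots,e(x_n^d)$, its vertices being the exponent vectors of all monomials of degree $d$; a vertex is said to be in an ideal if its label is. *)

(* Defs.v *)
From mathcomp Require Import all_boot all_order all_algebra.
From mathcomp Require Import finmap mpoly.
From mathcomp Require Import boolp classical_sets functions cardinality reals.

Set Implicit Arguments.
Unset Strict Implicit.
Unset Printing Implicit Defensive.

Import Order.TTheory GRing.Theory Num.Theory.
Local Open Scope classical_set_scope.
Local Open Scope ring_scope.

(* The variables x_1, ..., x_n are 'X_i for i : 'I_n, hence numbered from 0;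
   a monomial x^m is given by its exponent vector m : 'X_{1..n}. *)

(** * Monomial ideals *)

Definition ideal (k : fieldType) (n : nat) (J : set {mpoly k[n]}) : Prop :=
  [/\ J 0,
      forall p q, J p -> J q -> J (p + q)
    & forall p q, J q -> J (p * q)].

Definition monomials_ideal (k : fieldType) (n : nat) (M : set 'X_{1..n}) :
    set {mpoly k[n]} :=
  smallest (@ideal k n) [set 'X_[m] | m in M].
Arguments monomials_ideal k {n} M _.

Definition monomial_ideal (k : fieldType) (n : nat) (J : set {mpoly k[n]}) :
    Prop :=
  exists M : set 'X_{1..n}, J = monomials_ideal k M.

Definition minimal_generators (k : fieldType) (n : nat)
    (J : set {mpoly k[n]}) (M : set 'X_{1..n}) : Prop :=
  J = monomials_ideal k M /\
  forall M' : set 'X_{1..n}, M' `<=` M -> J = monomials_ideal k M' -> M' = M.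

(* G(J): the minimal monomial generating set of a monomial ideal J exists and
   is unique, so the M below is the only possible one. *)
Definition min_gens (k : fieldType) (n : nat) (J : set {mpoly k[n]}) :
    set 'X_{1..n} :=
  [set m | exists M, minimal_generators J M /\ M m].

Definition borel_fixed (k : fieldType) (n : nat) (J : set {mpoly k[n]}) :
    Prop :=
  monomial_ideal J /\
  forall (m : 'X_{1..n}) (t r : 'I_n),
    min_gens J m -> (0 < m t)%N -> (r < t)%N ->
    J 'X_[(m - U_(t) + U_(r))%MM].

Definition borel_ideal (k : fieldType) (n : nat) (M : set 'X_{1..n}) :
    set {mpoly k[n]} :=
  smallest (@borel_fixed k n) [set 'X_[m] | m in M].
Arguments borel_ideal k {n} M _.

Definition minimal_borel_generators (k : fieldType) (n s : nat)
    (ms : 'I_s -> 'X_{1..n}) : Prop :=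
  forall i : 'I_s,
    borel_ideal k [set ms j | j in [set j | j != i]]
      <> borel_ideal k (range ms).

Definition rlex_gt (n : nat) (m1 m2 : 'X_{1..n}) : Prop :=
  exists i : 'I_n,
    (m1 i < m2 i)%N /\ forall j : 'I_n, (i < j)%N -> m1 j = m2 j.

(** * Polytopes and polyhedral cell complexes *)

Definition conv (R : realType) (N : nat) (A : set 'rV[R]_N) : set 'rV[R]_N :=
  [set x | exists (r : nat) (p : 'I_r -> 'rV[R]_N) (c : 'I_r -> R),
     [/\ forall i, A (p i), forall i, 0 <= c i,
         \sum_i c i = 1 & x = \sum_i c i *: p i]].

Definition polytope (R : realType) (N : nat) (P : set 'rV[R]_N) : Prop :=
  exists A : set 'rV[R]_N, finite_set A /\ P = conv A.

Definition dotp (R : realType) (N : nat) (c x : 'rV[R]_N) : R :=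
  \sum_i c 0 i * x 0 i.

(* With c = 0 this makes both P and the empty set faces of P. *)
Definition face (R : realType) (N : nat) (P F : set 'rV[R]_N) : Prop :=
  exists (c : 'rV[R]_N) (b : R),
    (forall x, P x -> dotp c x <= b) /\ F = [set x | P x /\ dotp c x = b].

Definition affinely_independent (R : realType) (N d : nat)
    (p : 'I_d.+1 -> 'rV[R]_N) : Prop :=
  row_free (\matrix_(i < d) (p (lift ord0 i) - p ord0)).

(* The dimension of a nonempty polytope (the empty set gets the junk value 0
   and is never given to this function below). *)
Definition dim (R : realType) (N : nat) (P : set 'rV[R]_N) : nat :=
  \max_(d < N.+1 | `[< exists p : 'I_d.+1 -> 'rV[R]_N,
                        (forall i, P (p i)) /\ affinely_independent p >]) d.

Definition vertices (R : realType) (N : nat) (P : set 'rV[R]_N) :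
    set 'rV[R]_N :=
  [set v | face P [set v]].

Definition facet (R : realType) (N : nat) (P F : set 'rV[R]_N) : Prop :=
  [/\ F !=set0, face P F & dim P = (dim F).+1].

Definition polyhedral_complex (R : realType) (N : nat)
    (X : {fset set 'rV[R]_N}) : Prop :=
  [/\ X != fset0,
      forall P, P \in X -> polytope P,
      forall P F, P \in X -> face P F -> F \in X
    & forall P P', P \in X -> P' \in X ->
        face P (P `&` P') /\ face P' (P `&` P')].

Definition complex_vertices (R : realType) (N : nat)
    (X : {fset set 'rV[R]_N}) : set 'rV[R]_N :=
  [set v | [set v] \in X].

(* Only pairs of nonempty faces are considered; the edge condition is what the
   usual normalization eps v set0 = 1 for vertices v amounts to. *)
Definition incidence_function (R : realType) (N : nat)
    (X : {fset set 'rV[R]_N}) (eps : set 'rV[R]_N -> set 'rV[R]_N -> int) :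
    Prop :=
  [/\ forall F F', F \in X -> F' \in X -> facet F F' ->
        eps F F' = 1 \/ eps F F' = -1,
      forall F F', F \in X -> F' \in X -> F !=set0 -> F' !=set0 ->
        ~ facet F F' -> eps F F' = 0,
      forall F v w, F \in X -> facet F [set v] -> facet F [set w] -> v <> w ->
        eps F [set v] + eps F [set w] = 0
    & forall F F1 F2 F', F \in X -> F1 <> F2 ->
        facet F F1 -> facet F1 F' -> facet F F2 -> facet F2 F' ->
        eps F F1 * eps F1 F' + eps F F2 * eps F2 F' = 0].

(** * Multigraded free complexes and resolutions *)

(* A finitely generated Z^n-graded free complex over S = k[x_1, ..., x_n], with
   a homogeneous basis; fc_diff b b' is the coefficient of b' in the
   differential of b.  All homological degrees are put together: a chain is an
   element of the direct sum of all the modules of the complex. *)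
Record free_complex (k : fieldType) (n : nat) := FreeComplex {
  fc_basis :> finType;
  fc_hdeg : fc_basis -> nat;
  fc_mdeg : fc_basis -> 'X_{1..n};
  fc_diff : fc_basis -> fc_basis -> {mpoly k[n]}
}.

Definition chain (k : fieldType) (n : nat) (C : free_complex k n) : Type :=
  {ffun C -> {mpoly k[n]}}.

Definition in_hdeg (k : fieldType) (n : nat) (C : free_complex k n)
    (i : nat) (f : chain C) : Prop :=
  forall b, f b != 0 -> fc_hdeg b = i.

Definition bd (k : fieldType) (n : nat) (C : free_complex k n)
    (f : chain C) : chain C :=
  [ffun b' => \sum_b f b * fc_diff b b'].

Definition is_complex (k : fieldType) (n : nat) (C : free_complex k n) : Prop :=
  [/\ forall b b' : C, fc_diff b b' != 0 -> fc_hdeg b = (fc_hdeg b').+1,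
      forall (b b' : C) (m : 'X_{1..n}), (fc_diff b b')@_m != 0 ->
        (m + fc_mdeg b')%MM = fc_mdeg b
    & forall (f : chain C) (b : C), bd (bd f) b = 0].

(* The S-linear map to S determined by its values on the basis. *)
Definition ev (k : fieldType) (n : nat) (C : free_complex k n)
    (aug : C -> {mpoly k[n]}) (f : chain C) : {mpoly k[n]} :=
  \sum_b f b * aug b.

(* The complex C resolves I: there is a homogeneous augmentation F_0 -> S
   such that ... -> F_1 -> F_0 -> I -> 0 is exact. *)
Definition free_resolution (k : fieldType) (n : nat) (C : free_complex k n)
    (I : set {mpoly k[n]}) : Prop :=
  is_complex C /\
  exists aug : C -> {mpoly k[n]},
    [/\ forall (b : C) (m : 'X_{1..n}),
          fc_hdeg b = 0%N -> (aug b)@_m != 0 -> m = fc_mdeg b,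
        I = [set ev aug f | f in @in_hdeg k n C 0],
        forall f : chain C, in_hdeg 0 f ->
          (ev aug f = 0 <-> exists g : chain C, in_hdeg 1 g /\ bd g = f)
      & forall (i : nat) (f : chain C), in_hdeg i.+1 f -> bd f = [ffun=> 0] ->
          exists g : chain C, in_hdeg i.+2 g /\ bd g = f].

(* The differential has its image in (x_1, ..., x_n) F. *)
Definition minimal_complex (k : fieldType) (n : nat) (C : free_complex k n) :
    Prop :=
  forall (f : chain C) (b : C), (bd f b)@_0%MM = 0.

(** * Cellular resolutions *)

Definition cell (R : realType) (N : nat) (X : {fset set 'rV[R]_N}) : finType :=
  {F : X | val F != set0}.

Definition cell_set (R : realType) (N : nat) (X : {fset set 'rV[R]_N})
    (F : cell X) : set 'rV[R]_N := val (val F).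

Definition face_label (R : realType) (N n : nat)
    (lab : 'rV[R]_N -> 'X_{1..n}) (F : set 'rV[R]_N) : 'X_{1..n} :=
  \big[@mlcm n/0%MM]_(v <- fset_set (vertices F)) lab v.

Definition cellular_complex (k : fieldType) (R : realType) (N n : nat)
    (X : {fset set 'rV[R]_N}) (lab : 'rV[R]_N -> 'X_{1..n})
    (eps : set 'rV[R]_N -> set 'rV[R]_N -> int) : free_complex k n :=
  @FreeComplex k n (cell X)
    (fun F => dim (cell_set F))
    (fun F => face_label lab (cell_set F))
    (fun F F' =>
       (eps (cell_set F) (cell_set F'))%:~R *:
         'X_[(face_label lab (cell_set F) - face_label lab (cell_set F'))%MM]).

(* Cellular complexes are taken with respect to an arbitrary incidence
   function; the existence clause prevents the condition from being vacuous. *)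
Definition supports_minimal_free_resolution (k : fieldType) (R : realType)
    (N n : nat) (X : {fset set 'rV[R]_N}) (lab : 'rV[R]_N -> 'X_{1..n})
    (I : set {mpoly k[n]}) : Prop :=
  [/\ set_bij (complex_vertices X) (min_gens I) lab,
      exists eps, incidence_function X eps
    & forall eps, incidence_function X eps ->
        free_resolution (cellular_complex k X lab eps) I /\
        minimal_complex (cellular_complex k X lab eps)].

(** * The complex P_d(x_1, ..., x_n) *)

Definition expv (R : realType) (n : nat) (m : 'X_{1..n}) : 'rV[R]_n :=
  \row_i (m i)%:R.

Definition Delta (R : realType) (n a b : nat) : set (set 'rV[R]_n) :=
  [set F | exists A : {set 'I_n},
     (forall i, i \in A -> (a <= i <= b)%N) /\
     F = conv [set delta_mx 0 i | i in [set` A]]].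
Arguments Delta R n a b _ : clear implicits.

(* P_d(x_{a+1}, ..., x_{b+1}).  The case d = 0, a single point, is a convention
   extending the recursion downwards. *)
Fixpoint Pd (R : realType) (n d a b : nat) : set (set 'rV[R]_n) :=
  match d with
  | 0 => [set F | F = set0 \/ F = [set 0]]
  | 1 => Delta R n a b
  | d'.+1 =>
      [set H | exists k : nat, (a <= k <= b)%N /\
         exists F G, [/\ Delta R n a k F, @Pd R n d' k b G
                       & H = [set x + y | x in F & y in G]]]
  end.
Arguments Pd R n d a b _ : clear implicits.

(* Main.v *)
Require Import Defs.
From mathcomp Require Import all_boot all_order all_algebra.
From mathcomp Require Import finmap mpoly.
From mathcomp Require Import boolp classical_sets functions cardinality reals.
From mathcomp Require Import zify.

Set Implicit Arguments.
Unset Strict Implicit.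
Unset Printing Implicit Defensive.

Import Order.TTheory GRing.Theory Num.Theory.
Local Open Scope ring_scope.

(** Let B be the set of monomials reached from the given ones by Borel moves
    x_t -> x_r, r < t. The ideal I is generated by B (borel_ideal_closure), and as
    B lies in a single degree d it is the minimal generating set of I. From then
    on only the fact that B is Borel closed is used.

    A nonempty cell of P_d is a sum of d simplices with vertex sets
    A_1, ..., A_d such that max A_i <= min A_(i+1). It is recorded by the set T of
    the pairs (i, j) with j in A_i: a chain for the product order, here called a
    staircase, which meets every row. The key to the geometry is that a point is
    in at most one way a sum of points y_1, ..., y_d of the standard simplex with
    supports increasing in this sense: lay the coordinates of the point end to end
    on the interval [0, d] and cut it at the integers (weights_unique). Moreover,
    on a given cell the coordinates of the y_i are affine functions of the point.
    Hence the cells of T and T' meet in the cell of their intersection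
    (cellofI), the nonempty faces of a cell are the cells of the subsets of T still
    meeting all rows (face_cellof, face_cellof_inv), the dimension is #|T| - d
    (dim_cellof), and the vertices are the transversals of T. The label of the cell
    is the product of the x_j over all (i, j) in T (label_cellof), so the
    differential removes an element (i, j) of T and multiplies by x_j; in
    particular it is minimal. The usual simplicial signs give an incidence
    function.

    Exactness is proved in each multidegree m, where the complex is spanned by
    the staircases T with transversals in B whose label divides x^m. Let s be the
    greedy transversal, the sorted list of the d first variables of x^m counted
    with multiplicity. Every such T lies weakly above s (greedy_lower). If i is the
    first row in which T differs from s, then (i, s i) can be added to T or removed
    from it without leaving the complex: Borel closedness is what makes the
    addition possible (inB_cell_add). These toggles form an acyclic matching with
    the graph of s as its only unmatched cell, so a cycle can be pushed row by row
    onto the graph of s (push_row) and the strand is exact (strand_exact). This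
    argument works for every incidence function, since it only divides by
    incidences of facets, which are units. *)
(** * Monomial ideals and Borel closures *)

Section MonomialIdeals.
Local Open Scope classical_set_scope.


Lemma ideal_sum (k : fieldType) (n : nat) (J : set {mpoly k[n]}) (I : Type)
    (r : seq I) (P : pred I) (F : I -> {mpoly k[n]}) :
  ideal J -> (forall i, P i -> J (F i)) -> J (\sum_(i <- r | P i) F i).
Proof.
by case=> J0 JD _ JF; elim/big_rec: _ => // i x Pi Jx; apply/JD/Jx/JF.
Qed.

Lemma monomials_idealP (k : fieldType) (n : nat) (M : set 'X_{1..n})
    (p : {mpoly k[n]}) :
  monomials_ideal k M p <->
  forall m, m \in msupp p -> exists2 u, M u & (u <= m)%MM.
Proof.
split.
- pose J : set {mpoly k[n]} :=
    [set p | forall m, m \in msupp p -> exists2 u, M u & (u <= m)%MM].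
  move=> /(_ J); apply; split; first split.
  + by move=> m; rewrite msupp0.
  + by move=> q r Jq Jr m /msuppD_le; rewrite mem_cat => /orP[/Jq|/Jr].
  + move=> q r Jr m /msuppM_le /allpairsP[[m1 m2] /= [_ /Jr[u Mu le_u] ->]].
    by exists u => //; apply: lepm_trans le_u (lem_addl _ _).
  + by move=> _ [m Mm <-] m'; rewrite msuppX inE => /eqP ->; exists m => //; exact: lepm_refl.
- move=> suppM J [idJ MJ]; rewrite [p]mpolyE big_seq.
  apply: ideal_sum => // m /suppM[u Mu le_um].
  case: idJ => _ _ JM; rewrite -(submK le_um) mpolyXD scalerAl; apply: JM.
  by apply: MJ; exists u.
Qed.

Lemma monomials_idealX (k : fieldType) (n : nat) (M : set 'X_{1..n}) m :
  monomials_ideal k M 'X_[m] <-> exists2 u, M u & (u <= m)%MM.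
Proof.
rewrite monomials_idealP; split=> [/(_ m)|Mm m'].
  by apply; rewrite msuppX inE.
by rewrite msuppX inE => /eqP ->.
Qed.

Lemma monomials_ideal_ideal (k : fieldType) (n : nat) (M : set 'X_{1..n}) :
  ideal (monomials_ideal k M).
Proof.
split.
- by move=> J [[]].
- by move=> p q Jp Jq J JM; have [[_ JD _] _] := JM; apply: JD; [exact: Jp|exact: Jq].
- by move=> p q Jq J JM; have [[_ _ JX] _] := JM; apply: JX; exact: Jq.
Qed.

Lemma lepm_mdeg n (u m : 'X_{1..n}) : (u <= m)%MM -> (mdeg u <= mdeg m)%N.
Proof. by move=> /submK <-; rewrite mdegD leq_addl. Qed.

Lemma lepm_mdeg_eq n (u m : 'X_{1..n}) :
  (u <= m)%MM -> mdeg u = mdeg m -> u = m.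
Proof.
move=> /submK um /eqP; rewrite -um mdegD -[X in X == _]add0n eqn_add2r eq_sym.
by rewrite mdeg_eq0 => /eqP ->; rewrite add0m.
Qed.

Lemma lepm_anti n (u m : 'X_{1..n}) : (u <= m)%MM -> (m <= u)%MM -> u = m.
Proof.
move=> um mu; apply: lepm_mdeg_eq => //; apply/eqP.
by rewrite eqn_leq !lepm_mdeg.
Qed.

(** In a minimal generating set no generator divides another one, so every
    generating set contains it. *)
Lemma min_gens_sub (k : fieldType) (n : nat) (B : set 'X_{1..n}) :
  min_gens (monomials_ideal k B) `<=` B.
Proof.
move=> m [M [[eqBM minM] Mm]].
have Jm : monomials_ideal k B 'X_[m].
  by rewrite eqBM; apply/monomials_idealX; exists m => //; exact: lepm_refl.
have [u Bu le_um] := (monomials_idealX _ _ _).1 Jm.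
have : monomials_ideal k B 'X_[u].
  by apply/monomials_idealX; exists u => //; exact: lepm_refl.
rewrite eqBM => /monomials_idealX[w Mw le_wu].
have [eq_wm|ne_wm] := pselect (w = m).
  by rewrite -(lepm_anti le_um) // -eq_wm.
have subM : M `\ m `<=` M by move=> v [].
suff /(minM _ subM) eqM : monomials_ideal k B = monomials_ideal k (M `\ m).
  by move: Mm; rewrite -eqM => -[_ []].
rewrite eqBM; apply/seteqP; split=> p /monomials_idealP Mp.
  apply/monomials_idealP => m' /Mp[v Mv le_vm'].
  have [eq_vm|ne_vm] := pselect (v = m); last by exists v.
  exists w => //; apply: lepm_trans le_vm'; apply: lepm_trans le_wu _.
  by rewrite eq_vm.
by apply/monomials_idealP => m' /Mp[v [Mv _] le_vm']; exists v.
Qed.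

(** Descent on the degree: a monomial of the ideal none of whose proper
    divisors lies in the ideal is a minimal generator, and such monomials
    suffice to generate. *)
Lemma min_gens_dvd (k : fieldType) (n : nat) (J : set {mpoly k[n]}) m :
  monomial_ideal J -> J 'X_[m] -> exists2 u, min_gens J u & (u <= m)%MM.
Proof.
move=> [M defJ].
pose G := [set u : 'X_{1..n} | J 'X_[u] /\
  forall v, J 'X_[v] -> (v <= u)%MM -> v = u].
have dvdG d : forall u : 'X_{1..n}, (mdeg u <= d)%N -> J 'X_[u] ->
    exists2 v, G v & (v <= u)%MM.
  elim: d => [|d IHd] u du Ju.
    exists u; last exact: lepm_refl.
    split=> // v Jv le_vu; apply: lepm_mdeg_eq => //.
    by move: (lepm_mdeg le_vu); lia.
  have [Gu|] := pselect (G u); first by exists u => //; exact: lepm_refl.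
  move=> /not_andP[//|/existsNP[v /not_implyP[Jv /not_implyP[le_vu ne_vu]]]].
  have [|w Gw le_wv] := IHd v _ Jv.
    rewrite leqNgt; apply/negP => lt_dv; apply: ne_vu.
    by apply: lepm_mdeg_eq => //; move: (lepm_mdeg le_vu); lia.
  by exists w => //; exact: lepm_trans le_wv le_vu.
have JG : J = monomials_ideal k G.
  apply/seteqP; split=> p.
    rewrite defJ => /monomials_idealP Mp; apply/monomials_idealP => u /Mp.
    move=> [v Mv le_vu]; apply: (dvdG (mdeg u)) => //.
    by rewrite defJ; apply/monomials_idealX; exists v.
  move=> /monomials_idealP Gp; rewrite defJ; apply/monomials_idealP => u /Gp.
  move=> [v [Jv _] le_vu]; move: Jv; rewrite defJ => /monomials_idealX[w Mw].
  by move=> le_wv; exists w => //; exact: lepm_trans le_wv le_vu.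
move=> /(dvdG _ _ (leqnn _))[u Gu le_um]; exists u => //.
exists G; split=> //; split=> // M' subM' JM'.
apply/seteqP; split=> // v [Jv minv].
move: (Jv); rewrite {1}JM' => /monomials_idealX[w M'w le_wv].
by rewrite -(minv w _ le_wv) //; have [] := subM' _ M'w.
Qed.

(** Divisibility between monomials of the same degree is equality. *)
Lemma min_gens_eqdeg (k : fieldType) (n d : nat) (B : set 'X_{1..n}) :
  (forall m, B m -> mdeg m = d) -> min_gens (monomials_ideal k B) = B.
Proof.
move=> degB; apply/seteqP; split=> [|m Bm]; first exact: min_gens_sub.
exists B; split=> //; split=> // M subM eqBM; apply/seteqP; split=> // u Bu.
have : monomials_ideal k B 'X_[u].
  by apply/monomials_idealX; exists u => //; exact: lepm_refl.
rewrite eqBM => /monomials_idealX[v Mv le_vu].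
by rewrite -(lepm_mdeg_eq le_vu) // !degB//; apply: subM.
Qed.

Definition borel_closed (n : nat) (B : set 'X_{1..n}) : Prop :=
  forall (m : 'X_{1..n}) (t r : 'I_n), B m -> (0 < m t)%N -> (r < t)%N ->
    B (m - U_(t) + U_(r))%MM.

Definition borel_closure (n : nat) (M : set 'X_{1..n}) : set 'X_{1..n} :=
  smallest (@borel_closed n) M.

Lemma borel_closure_closed n (M : set 'X_{1..n}) :
  borel_closed (borel_closure M).
Proof.
by move=> m t r Bm mt rt B' [clB' MB']; apply: (clB') => //; exact: Bm.
Qed.

Lemma borel_move_mdeg n (m : 'X_{1..n}) (t r : 'I_n) : (0 < m t)%N ->
  mdeg (m - U_(t) + U_(r))%MM = mdeg m.
Proof.
move=> mt; have /submK {2}<- : (U_(t) <= m)%MM by rewrite lep1mP -lt0n.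
by rewrite !mdegD !mdeg1.
Qed.

Lemma borel_closure_mdeg n d (M : set 'X_{1..n}) :
  (forall m, M m -> mdeg m = d) -> forall m, borel_closure M m -> mdeg m = d.
Proof.
move=> degM m /(_ [set m | mdeg m = d]); apply; split=> // u t r /= <- ut _.
exact: borel_move_mdeg.
Qed.

(** Being Borel fixed constrains only the minimal generators, but the exchange
    property passes to all monomials of the ideal: a minimal generator u
    dividing m either still divides m / x_t, or involves x_t as much as m. *)
Lemma borel_fixed_closed (k : fieldType) (n : nat) (J : set {mpoly k[n]}) :
  borel_fixed J -> borel_closed [set m | J 'X_[m]].
Proof.
move=> [monJ movJ] m t r /= Jm mt rt.
have [M defJ] := monJ.
have JdvdX (u v : 'X_{1..n}) : J 'X_[u] -> (u <= v)%MM -> J 'X_[v].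
  rewrite defJ => /monomials_idealX[w Mw wu] uv; apply/monomials_idealX.
  by exists w => //; apply: lepm_trans uv.
have [u Gu le_um] := min_gens_dvd monJ Jm.
have [le_u|] := boolP (u <= m - U_(t))%MM.
  have [v Ju] : exists2 v, J 'X_[v] & (v <= m - U_(t))%MM.
    exists u => //; case: Gu => G [[-> _] Gu].
    by apply/monomials_idealX; exists u => //; exact: lepm_refl.
  by move=> le_v; apply: JdvdX Ju (lepm_trans le_v (lem_addr _ _)).
move=> nle_u; have ut : u t = m t.
  apply/eqP; rewrite eqn_leq (mnm_lepP le_um) /= leqNgt; apply/negP => lt_ut.
  case/negP: nle_u; apply/mnm_lepP => i; rewrite mnmBE mnm1E.
  case: eqP => [<-|_]; first by lia.
  by rewrite subn0 (mnm_lepP le_um).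
apply: (JdvdX (u - U_(t) + U_(r))%MM).
  by apply: movJ => //; rewrite ut.
apply/mnm_lepP => i; rewrite !mnmDE !mnmBE leq_add2r leq_sub2r //.
exact: (mnm_lepP le_um).
Qed.

(** The minimal generators of the right-hand side belong to the closure, which
    is stable under Borel moves, so that this ideal is Borel fixed; it is the
    smallest one because the monomials of a Borel fixed ideal form a Borel
    closed set. *)
Lemma borel_ideal_closure (k : fieldType) (n : nat) (M : set 'X_{1..n}) :
  borel_ideal k M = monomials_ideal k (borel_closure M).
Proof.
apply/seteqP; split.
- move=> p /(_ (monomials_ideal k (borel_closure M))); apply; split.
    split; first by exists (borel_closure M).
    move=> m t r /min_gens_sub Bm mt rt; apply/monomials_idealX.
    exists (m - U_(t) + U_(r))%MM; last exact: lepm_refl.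
    exact: borel_closure_closed.
  move=> _ [m Mm <-]; apply/monomials_idealX; exists m; last exact: lepm_refl.
  by move=> B [_]; apply.
- move=> p Bp J [fixJ MJ]; apply: Bp; split.
    by case: fixJ => [[B ->] _]; exact: monomials_ideal_ideal.
  move=> _ [m /(_ [set m | J 'X_[m]]) Bm <-]; apply: Bm; split.
    exact: borel_fixed_closed.
  by move=> u Mu; apply: MJ; exists u.
Qed.

End MonomialIdeals.

(** * Staircases *)

Section Staircases.
Import fintype mathcomp.boot.finset.
Variables (d n : nat).
Implicit Types (T : {set 'I_d * 'I_n}) (s : {ffun 'I_d -> 'I_n}).

(** A pair (i, j) stands for the vertex j of the i-th summand of a cell of P_d,
    which is a Minkowski sum of d simplices. That the vertices of a summand do
    not exceed those of the next ones says that T is a chain for the product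
    order. *)
Definition staircase T :=
  [forall p in T, forall q in T, (p.1 < q.1)%N ==> (p.2 <= q.2)%N].

Definition meets_rows T := [forall i, exists j, (i, j) \in T].

(** A choice of one vertex in each summand, that is, a vertex of the cell. *)
Definition graph s : {set 'I_d * 'I_n} := [set p | s p.1 == p.2].

Definition transversal_mnm s : 'X_{1..n} := (\sum_i U_(s i))%MM.

(** In a column j of T one can choose j simultaneously in all the rows meeting
    this column, so this is the least common multiple of the monomials of the
    transversals of T. *)
Definition cell_mnm T : 'X_{1..n} := (\sum_(p in T) U_(p.2))%MM.

Definition inB_cell (B : set 'X_{1..n}) T : Prop :=
  [/\ staircase T, meets_rows T
    & forall s, graph s \subset T -> B (transversal_mnm s)].

Lemma staircaseP T :
  reflect (forall i j i' j', (i, j) \in T -> (i', j') \in T -> (i < i')%N ->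
             (j <= j')%N) (staircase T).
Proof.
apply: (iffP forall_inP) => [H i j i' j' Tij Tij' lt_ii'|H [i j] Tij].
  by have /forall_inP/(_ _ Tij')/implyP := H _ Tij; apply.
by apply/forall_inP => -[i' j'] Tij'; apply/implyP; apply: H.
Qed.

Lemma staircaseS T T' : T' \subset T -> staircase T -> staircase T'.
Proof.
move=> /subsetP sub /staircaseP sT; apply/staircaseP => i j i' j' /sub Tij.
by move=> /sub; apply: sT.
Qed.

Lemma meets_rowsP T : reflect (forall i, exists j, (i, j) \in T) (meets_rows T).
Proof. exact: 'forall_existsP. Qed.

Lemma meets_rowsS T T' : T' \subset T -> meets_rows T' -> meets_rows T.
Proof.
move=> /subsetP sub /meets_rowsP fT; apply/meets_rowsP => i.
by have [j /sub] := fT i; exists j.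
Qed.

Lemma inB_cellS B T T' :
  inB_cell B T -> T' \subset T -> meets_rows T' -> inB_cell B T'.
Proof.
move=> [sT _ BT] sub fT'; split=> //; first exact: staircaseS sT.
by move=> s ss; apply: BT; apply: subset_trans sub.
Qed.

Lemma graphP s T : reflect (forall i, (i, s i) \in T) (graph s \subset T).
Proof.
apply: (iffP subsetP) => [sT i|sT [i j]]; first by apply: sT; rewrite inE /=.
by rewrite inE /= => /eqP <-.
Qed.

Lemma mem_graph s i j : ((i, j) \in graph s) = (s i == j).
Proof. by rewrite inE. Qed.

Lemma card_graph s : #|graph s| = d.
Proof.
have -> : graph s = [set (i, s i) | i : 'I_d].
  apply/setP => -[i j]; rewrite mem_graph; apply/eqP/imsetP => [<-|].
    by exists i.
  by move=> [i' _ [-> ->]].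
by rewrite card_imset ?card_ord // => i i' [].
Qed.

Lemma meets_rows_graph s : meets_rows (graph s).
Proof. by apply/meets_rowsP => i; exists (s i); rewrite mem_graph. Qed.

Lemma graph_inj : injective graph.
Proof.
move=> s s' eqs; apply/ffunP => i; apply/eqP.
by rewrite eq_sym -mem_graph -eqs mem_graph.
Qed.

Lemma staircase_graph s :
  staircase (graph s) <-> forall i i' : 'I_d, (i < i')%N -> (s i <= s i')%N.
Proof.
split=> [/staircaseP sT i i'|ms]; first by apply: sT; rewrite mem_graph.
by apply/staircaseP => i j i' j'; rewrite !mem_graph => /eqP <- /eqP <- /ms.
Qed.

Definition set_row s i j : {ffun 'I_d -> 'I_n} :=
  [ffun i' => if i' == i then j else s i'].

Lemma set_row_sub s i j T : graph s \subset T -> (i, j) \in T ->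
  graph (set_row s i j) \subset T.
Proof.
move=> /graphP sT Tij; apply/graphP => i'; rewrite ffunE.
by case: eqP => [->|].
Qed.

Lemma transversal_exists T : meets_rows T -> exists s, graph s \subset T.
Proof.
move=> /meets_rowsP/boolp.choice[f fP]; exists [ffun i => f i].
by apply/graphP => i; rewrite ffunE.
Qed.

Lemma transversal_through T i j : meets_rows T -> (i, j) \in T ->
  exists2 s, graph s \subset T & s i = j.
Proof.
move=> /transversal_exists[s sT] Tij; exists (set_row s i j).
  exact: set_row_sub.
by rewrite ffunE eqxx.
Qed.

Lemma meets_rows_card T : meets_rows T -> (d <= #|T|)%N.
Proof.
by move=> /transversal_exists[s /subset_leq_card]; rewrite card_graph.
Qed.

Lemma meets_rows_card_eq T : meets_rows T -> #|T| = d -> exists s, T = graph s.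
Proof.
move=> /transversal_exists[s sT] cT; exists s; apply/esym/eqP.
by rewrite eqEcard sT card_graph cT /=.
Qed.

Lemma meets_rowsD1 T i j j' : meets_rows T -> (i, j') \in T -> j' != j ->
  meets_rows (T :\ (i, j)).
Proof.
move=> /meets_rowsP fT Tij' ne; apply/meets_rowsP => i0.
have [->|ne_i] := eqVneq i0 i.
  by exists j'; rewrite !inE Tij' andbT xpair_eqE eqxx.
have [j0 Tj0] := fT i0; exists j0; rewrite !inE Tj0 andbT xpair_eqE.
by rewrite (negPf ne_i).
Qed.

Lemma meets_rowsD1_ex T i j : meets_rows (T :\ (i, j)) ->
  exists2 j', (i, j') \in T & j' != j.
Proof.
move=> /meets_rowsP/(_ i)[j']; rewrite !inE xpair_eqE eqxx => /andP[ne Tij'].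
by exists j'.
Qed.

Lemma cell_mnmE T j : cell_mnm T j = #|[set p in T | p.2 == j]|.
Proof.
rewrite /cell_mnm mnm_sumE -sum1_card.
rewrite (eq_bigr (fun p : 'I_d * 'I_n => (p.2 == j) : nat)); last first.
  by move=> p _; rewrite mnm1E.
rewrite [RHS](eq_bigl (fun p => (p \in T) && (p.2 == j))); last first.
  by move=> p; rewrite inE.
by rewrite big_mkcondr.
Qed.

Lemma cell_mnm_graph s : cell_mnm (graph s) = transversal_mnm s.
Proof.
rewrite /cell_mnm /transversal_mnm.
rewrite (eq_bigl (fun p : 'I_d * 'I_n => s p.1 == p.2)); last first.
  by move=> p; rewrite inE.
rewrite -(pair_big_dep xpredT (fun i j => s i == j) (fun _ j => U_(j)%MM)) /=.
by apply: eq_bigr => i _; rewrite (eq_bigl (pred1 (s i))) ?big_pred1_eq.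
Qed.

Lemma transversal_mnmE s j : transversal_mnm s j = #|[set i | s i == j]|.
Proof.
rewrite /transversal_mnm mnm_sumE -sum1_card.
rewrite [RHS](eq_bigl (fun i => s i == j)); last by move=> i; rewrite inE.
by rewrite [RHS]big_mkcond; apply: eq_bigr => i _; rewrite mnm1E.
Qed.

Lemma cell_mnmS T T' : T' \subset T -> (cell_mnm T' <= cell_mnm T)%MM.
Proof.
move=> /subsetP sub; apply/mnm_lepP => j; rewrite !cell_mnmE subset_leq_card //.
by apply/subsetP => p; rewrite !inE => /andP[/sub -> ->].
Qed.

Lemma cell_mnmU1 T p : p \notin T ->
  cell_mnm (p |: T) = (U_(p.2) + cell_mnm T)%MM.
Proof. by move=> pT; rewrite /cell_mnm big_setU1. Qed.

Lemma mdeg_transversal_mnm s : mdeg (transversal_mnm s) = d.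
Proof.
rewrite /transversal_mnm mdeg_sum (eq_bigr (fun=> 1%N)).
  by rewrite sum1_card card_ord.
by move=> i _; rewrite mdeg1.
Qed.

Lemma transversal_mnm_set_row s i j :
  transversal_mnm (set_row s i j) = (transversal_mnm s - U_(s i) + U_(j))%MM.
Proof.
rewrite /transversal_mnm (bigD1 i) //= [in RHS](bigD1 i) //= ffunE eqxx.
rewrite [(U_(s i) + _)%MM]addmC addmK addmC; congr (_ + _)%MM.
by apply: eq_bigr => i' /negPf ne; rewrite ffunE ne.
Qed.

(** ** The greedy transversal below a monomial *)

Definition prefix_deg (m : 'X_{1..n}) (c : nat) := (\sum_(j < n | j < c) m j)%N.

Lemma prefix_degS m (j : 'I_n) :
  prefix_deg m j.+1 = (m j + prefix_deg m j)%N.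
Proof.
rewrite /prefix_deg (bigD1 j) //=; congr (_ + _)%N; apply: eq_bigl => j'.
by rewrite ltnS ltn_neqAle andbC.
Qed.

Lemma prefix_deg_le m c c' : (c <= c')%N -> (prefix_deg m c <= prefix_deg m c')%N.
Proof.
move=> le_cc'; rewrite /prefix_deg big_mkcond [leqRHS]big_mkcond leq_sum // => j _.
by case: ifP => // lt_jc; rewrite (leq_trans lt_jc).
Qed.

Lemma prefix_deg_lem m m' c : (m <= m')%MM -> (prefix_deg m c <= prefix_deg m' c)%N.
Proof. by move=> /mnm_lepP le_mm'; apply: leq_sum. Qed.

(** The sorted list of the variables of m with multiplicity, cut after d
    entries: its i-th entry is the variable occupying the unit interval
    [i, i + 1] when variable j is laid over an interval of length m j. *)
Definition greedy m s :=
  forall i : 'I_d, (prefix_deg m (s i) <= i < prefix_deg m (s i).+1)%N.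

Lemma greedy_exists m : (d <= mdeg m)%N -> exists s, greedy m s.
Proof.
move=> le_dm.
suff /boolp.choice[f fP] : forall i : 'I_d, exists j : 'I_n,
    (prefix_deg m j <= i < prefix_deg m j.+1)%N.
  by exists [ffun i => f i] => i; rewrite ffunE.
move=> i; have exc : exists c, (i < prefix_deg m c)%N.
  exists n; apply: leq_trans (ltn_ord i) (leq_trans le_dm _).
  by rewrite mdegE /prefix_deg [leqRHS](eq_bigl xpredT) // => j; rewrite ltn_ord.
case: (ex_minnP exc) => c lt_ic minc.
case: c lt_ic minc => [|c] lt_ic minc.
  by move: lt_ic; rewrite /prefix_deg big_pred0.
have lt_cn : (c < n)%N.
  rewrite ltnNge; apply/negP => le_nc.
  suff : (c < c)%N by rewrite ltnn.
  apply: minc; apply: leq_trans lt_ic _; rewrite /prefix_deg.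
  rewrite big_mkcond [leqRHS]big_mkcond leq_sum // => j _.
  by rewrite (leq_trans (ltn_ord j) le_nc) leqW // (leq_trans (ltn_ord j)).
exists (Ordinal lt_cn); rewrite lt_ic andbT leqNgt.
by apply/negP => /minc; rewrite ltnn.
Qed.

Lemma greedy_mono m s (i i' : 'I_d) : greedy m s -> (i <= i')%N -> (s i <= s i')%N.
Proof.
move=> gs le_ii'; rewrite leqNgt; apply/negP => lt_s.
have /andP[le_i _] := gs i; have /andP[_ lt_i'] := gs i'.
by have := prefix_deg_le m lt_s; lia.
Qed.

Lemma greedy_le m s : greedy m s -> (transversal_mnm s <= m)%MM.
Proof.
move=> gs; apply/mnm_lepP => j; rewrite transversal_mnmE cardE.
rewrite -(size_map val) -[leqRHS](size_iota (prefix_deg m j)).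
apply: uniq_leq_size; first by rewrite map_inj_uniq ?enum_uniq //; exact: val_inj.
move=> x /mapP[i]; rewrite mem_enum inE => /eqP eq_s ->.
by rewrite mem_iota; have := gs i; rewrite eq_s prefix_degS addnC.
Qed.

(** If some (i, j) in T had j < s i, a transversal of T through it would have
    its entries 0, ..., i among the variables 0, ..., j, whose total exponent
    in m is at most i by the choice of s i. *)
Lemma greedy_lower m s T i j : greedy m s -> staircase T -> meets_rows T ->
  (cell_mnm T <= m)%MM -> (i, j) \in T -> (s i <= j)%N.
Proof.
move=> gs /staircaseP sT fT le_Tm Tij; rewrite leqNgt; apply/negP => lt_js.
have /andP[le_i _] := gs i.
have := leq_trans (prefix_deg_le m lt_js) le_i; apply/negP; rewrite -ltnNge.
have [t tT tij] := transversal_through fT Tij.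
apply: leq_trans (prefix_deg_lem _ le_Tm).
apply: leq_trans (prefix_deg_lem _ (cell_mnmS tT)).
rewrite cell_mnm_graph /prefix_deg.
rewrite (eq_bigr (fun j' => \sum_(i' | t i' == j') 1)%N); last first.
  by move=> j' _; rewrite transversal_mnmE -sum1_card; apply: eq_bigl => i'; rewrite inE.
rewrite (exchange_big_dep (fun i' => t i' <= j)%N) /=; last first.
  by move=> j' i'; rewrite ltnS => le_j' /eqP ->.
rewrite (eq_bigr (fun=> 1%N)); last first.
  move=> i' le_t; rewrite (eq_bigl (pred1 (t i'))) ?big_pred1_eq // => j' /=.
  by rewrite eq_sym; case: eqP => [->|]; rewrite ?andbF // ltnS le_t.
have lt_id : (i.+1 <= d)%N by [].
have -> : (i.+1 = \sum_(i' < i.+1) 1)%N by rewrite sum1_card card_ord.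
rewrite (big_ord_widen_cond d xpredT (fun=> 1%N)) //.
rewrite big_mkcond [leqRHS]big_mkcond leq_sum // => i' _ /=.
case: ifP => // lt_i'; case: ifP => // /negP[].
have [->|ne_i] := eqVneq i' i; first by rewrite tij.
have /graphP tT' := tT.
by apply: (sT i' (t i') i j) => //; move: ne_i lt_i'; rewrite -val_eqE /=; lia.
Qed.

Lemma greedy_eq m s : greedy m s -> mdeg m = d -> transversal_mnm s = m.
Proof.
move=> gs dm; apply: lepm_mdeg_eq; first exact: greedy_le.
by rewrite mdeg_transversal_mnm.
Qed.

Lemma greedy_cell (B : set 'X_{1..n}) m : B m -> mdeg m = d ->
  exists2 s, inB_cell B (graph s) & transversal_mnm s = m.
Proof.
move=> Bm dm; have [s gs] : exists s, greedy m s.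
  by apply: greedy_exists; rewrite dm.
have eq_m := greedy_eq gs dm; exists s => //; split.
- by apply/staircase_graph => i i' lt_ii'; apply: greedy_mono gs (ltnW lt_ii').
- exact: meets_rows_graph.
- move=> s' sub; have -> : s' = s; last by rewrite eq_m.
  by apply: graph_inj; apply/eqP; rewrite eqEcard sub !card_graph leqnn.
Qed.

(** ** Toggling an element of the greedy transversal *)

Definition agree s i T := forall (i' : 'I_d) j, (i' < i)%N -> ((i', j) \in T) = (s i' == j).

Lemma agree0 s T : agree s 0 T. Proof. by []. Qed.

Lemma agree_max s T : agree s d T -> T = graph s.
Proof. by move=> aT; apply/setP => -[i j]; rewrite aT // mem_graph. Qed.

Lemma agreeS s (i : 'I_d) T : agree s i T ->
  (forall j, ((i, j) \in T) = (s i == j)) -> agree s i.+1 T.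
Proof.
move=> aT Ti i' j; rewrite ltnS leq_eqVlt => /orP[/eqP/val_inj ->|]//.
exact: aT.
Qed.

(** The new element lies weakly below everything in its row and in later rows,
    which gives the staircase condition. A transversal through it is a Borel
    move of a transversal of T. Finally, if it is new, then all elements of T
    in its column belong to the rows where T agrees with s, so the exponent of
    its column does not exceed the one in the monomial of s. *)
Lemma inB_cell_add m s (i : 'I_d) B T : borel_closed B -> greedy m s ->
    inB_cell B T -> (cell_mnm T <= m)%MM -> agree s i T ->
  inB_cell B ((i, s i) |: T) /\ (cell_mnm ((i, s i) |: T) <= m)%MM.
Proof.
move=> clB gs [sT fT BT] le_Tm aT.
have lowT i' j' : (i', j') \in T -> (s i' <= j')%N by apply: greedy_lower le_Tm.
have [Ti|nTi] := boolP ((i, s i) \in T).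
  by have /setUidPr -> : [set (i, s i)] \subset T by rewrite sub1set.
have [t Tit] := meets_rowsP _ fT i.
have lt_st : (s i < t)%N.
  rewrite ltn_neqAle lowT // andbT; apply/eqP => /val_inj eq_st.
  by rewrite eq_st Tit in nTi.
have sT' := staircaseP _ sT.
split; first split.
- apply/staircaseP => i1 j1 i2 j2; rewrite !in_setU1 !xpair_eqE.
  move=> /orP[/andP[/eqP -> /eqP ->]|T1] /orP[/andP[/eqP -> /eqP ->]|T2] lt12.
  + by [].
  + by apply: leq_trans (lowT _ _ T2); apply: greedy_mono gs (ltnW _).
  + by move: T1; rewrite aT // => /eqP <-; apply: greedy_mono gs (ltnW _).
  + exact: sT' T1 T2 lt12.
- by apply: meets_rowsS fT; apply: subsetUr.
- move=> r /graphP rT.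
  have rT' i' : i' != i -> (i', r i') \in T.
    by move=> ne; have := rT i'; rewrite in_setU1 xpair_eqE (negPf ne).
  have [ri|ne_ri] := eqVneq (r i) (s i); last first.
    apply: BT; apply/graphP => i'; have [->|/rT'//] := eqVneq i' i.
    by have := rT i; rewrite in_setU1 xpair_eqE (negPf ne_ri) andbF.
  have -> : r = set_row (set_row r i t) i (s i).
    by apply/ffunP => i'; rewrite !ffunE; case: eqP => [->|].
  rewrite transversal_mnm_set_row ffunE eqxx; apply: clB => //.
    apply: BT; apply/graphP => i'; rewrite ffunE.
    by case: eqP => [->//|/eqP/rT'].
  rewrite transversal_mnm_set_row mnmDE mnm1E eqxx; lia.
- apply/mnm_lepP => j; rewrite cell_mnmU1 // mnmDE mnm1E /=.
  have [<-|_] := eqVneq (s i) j; last exact: (mnm_lepP le_Tm).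
  apply: leq_trans ((mnm_lepP (greedy_le gs)) (s i)).
  rewrite -cell_mnm_graph !cell_mnmE.
  have -> : (true + #|[set p in T | p.2 == s i]|)%N
      = #|(i, s i) |: [set p in T | p.2 == s i]|.
    by rewrite cardsU1 inE (negPf nTi).
  apply/subset_leq_card/subsetP => -[i' j'].
  rewrite in_setU1 !inE /= xpair_eqE => /orP[/andP[/eqP -> /eqP ->]|].
    by rewrite !eqxx.
  move=> /andP[Tij' /eqP eq_j]; subst j'; rewrite eqxx andbT.
  have [lt_i|le_i] := ltnP i' i; first by rewrite -aT.
  move: le_i; rewrite leq_eqVlt => /orP[/eqP/val_inj eq_i|lt_i].
    by rewrite -eq_i (negPf nTi) in Tij'.
  by have := sT' _ _ _ _ Tit Tij' lt_i; lia.
Qed.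

End Staircases.

(** * The free complex of a family of staircases *)

Definition covers (U : finType) (S S' : {set U}) : bool :=
  (S' \subset S) && (#|S| == #|S'|.+1).

Section Covers.
Import fintype mathcomp.boot.finset.
Variable (U : finType).
Implicit Types (S : {set U}).

Lemma coversP S S' : reflect (exists2 p, p \in S & S' = S :\ p) (covers S S').
Proof.
apply: (iffP andP) => [[sub /eqP card]|[p pS ->]]; last first.
  by rewrite subD1set (cardsD1 p S) pS.
have : #|S :\: S'| == 1%N.
  by rewrite cardsD; move/setIidPr: sub => ->; rewrite card subSnn.
move=> /cards1P[p eqp]; exists p.
  by have : p \in S :\: S' by [rewrite eqp inE]; rewrite inE => /andP[].
by rewrite -eqp setDDr setDv set0U; apply/esym/setIidPr.
Qed.

End Covers.

Section Resolution.
Import fintype mathcomp.boot.finset.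
Variables (k : fieldType) (d n : nat) (B : set 'X_{1..n}).
Variables (C : finType) (T : C -> {set 'I_d * 'I_n}) (eps : C -> C -> int).

(** The differential removes one element (i, j) of a staircase and multiplies by
    the variable j, up to sign. *)
Definition staircase_complex : free_complex k n :=
  @FreeComplex k n C (fun b => #|T b| - d)%N (fun b => cell_mnm (T b))
    (fun b b' => (eps b b')%:~R *: 'X_[(cell_mnm (T b) - cell_mnm (T b'))%MM]).

Hypothesis B_deg : forall m, B m -> mdeg m = d.
Hypothesis B_closed : borel_closed B.
Hypothesis T_inj : injective T.
Hypothesis T_inB : forall b, inB_cell B (T b).
Hypothesis T_onto : forall S, inB_cell B S -> exists b, T b = S.
Hypothesis eps_unit : forall b b', covers (T b) (T b') ->
  eps b b' = 1 \/ eps b b' = -1.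
Hypothesis eps_zero : forall b b', ~~ covers (T b) (T b') -> eps b b' = 0.
Hypothesis eps_edge : forall b v w, #|T v| = d -> #|T w| = d ->
  covers (T b) (T v) -> covers (T b) (T w) -> v <> w ->
  eps b v + eps b w = 0.
Hypothesis eps_diamond : forall b b1 b2 b', b1 <> b2 ->
  covers (T b) (T b1) -> covers (T b1) (T b') ->
  covers (T b) (T b2) -> covers (T b2) (T b') ->
  eps b b1 * eps b1 b' + eps b b2 * eps b2 b' = 0.

Let T_full b : meets_rows (T b). Proof. by case: (T_inB b). Qed.

Let T_card b : (d <= #|T b|)%N. Proof. exact: meets_rows_card. Qed.

Lemma sub_cell b (S : {set 'I_d * 'I_n}) : S \subset T b -> meets_rows S -> exists c, T c = S.
Proof. by move=> sub fS; apply: T_onto; apply: inB_cellS sub fS. Qed.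

Lemma eps_neq0 b b' : eps b b' != 0 -> covers (T b) (T b').
Proof. by apply: contraNT => /eps_zero ->. Qed.

Lemma eps_sqr b b' : covers (T b) (T b') ->
  (eps b b')%:~R * (eps b b')%:~R = 1 :> k.
Proof. by move=> /eps_unit[] ->; rewrite ?rmorphN ?rmorph1 ?mulrNN mulr1. Qed.

(** Between two cells differing by two elements p and q lie exactly two cells,
    obtained by removing p or q. *)
Lemma eps_square_zero b b2 : \sum_b1 eps b b1 * eps b1 b2 = 0.
Proof.
have [all0|/existsNP[b1 /eqP]] :=
    pselect (forall b1, eps b b1 * eps b1 b2 = 0).
  exact: big1.
rewrite mulf_eq0 negb_or => /andP[/eps_neq0 cov1 /eps_neq0 cov2].
have [p pS defb1] := coversP _ _ cov1; have [q qS defb2] := coversP _ _ cov2.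
have [qb ne_pq] : q \in T b /\ q != p.
  by move: qS; rewrite defb1 !inE => /andP[].
have sub2 : T b2 \subset T b :\ q.
  by rewrite defb2 defb1; apply: setSD; apply: subD1set.
have [b1' defb1'] := sub_cell (subD1set (T b) q) (meets_rowsS sub2 (T_full b2)).
have ne1 : b1 <> b1'.
  move=> eqb; move: ne_pq; have : q \notin T b1' by rewrite defb1' !inE eqxx.
  by rewrite -eqb defb1 !inE qb andbT negbK => /eqP ->; rewrite eqxx.
have cov1' : covers (T b) (T b1') by apply/coversP; exists q.
have cov2' : covers (T b1') (T b2).
  apply/coversP; exists p; rewrite defb1' ?inE 1?eq_sym ?ne_pq //.
  by rewrite defb2 defb1 !setDDl setUC.
rewrite (bigD1 b1) //= (bigD1 b1') /=; last by apply/eqP => /esym.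
rewrite big1 ?addr0; first exact: eps_diamond.
move=> c /andP[/eqP ne_cb1 /eqP ne_cb1']; apply/eqP.
apply: contra_notT ne_cb1; rewrite mulf_eq0 negb_or.
move=> /andP[/eps_neq0/coversP[r rS defc] /eps_neq0/andP[subc _]].
apply: T_inj; rewrite defc defb1.
have : r \notin T b2.
  by apply/negP => /(subsetP subc); rewrite defc !inE eqxx.
rewrite defb2 defb1 !inE rS andbT negb_and !negbK => /orP[]/eqP eq_r.
  by case: ne_cb1'; apply: T_inj; rewrite defc defb1' eq_r.
by rewrite eq_r.
Qed.

(** An edge has exactly two end points, with opposite incidences. *)
Lemma eps_edge_sum b : #|T b| = d.+1 -> \sum_b' eps b b' = 0.
Proof.
move=> card_b.
have cov_card b' : covers (T b) (T b') -> #|T b'| = d.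
  by move=> /andP[_ /eqP]; rewrite card_b => -[].
have [all0|/existsNP[v /eqP/eps_neq0 covv]] := pselect (forall v, eps b v = 0).
  exact: big1.
have [[i j] pS defv] := coversP _ _ covv.
have := T_full v; rewrite defv => /meets_rowsD1_ex[j' Tij' ne_j].
have [w defw] : exists w, T w = T b :\ (i, j').
  apply: sub_cell (subD1set _ _) _; apply: meets_rowsD1 (T_full b) pS _.
  by rewrite eq_sym.
have covw : covers (T b) (T w) by apply/coversP; exists (i, j').
have ne_vw : v <> w.
  move=> eqvw; have := congr1 (fun S : {set _} => (i, j) \in S) (congr1 T eqvw).
  rewrite defv defw !inE eqxx pS xpair_eqE eqxx /= andbT => /esym/negP[].
  by rewrite eq_sym; exact/negP.
rewrite (bigD1 v) //= (bigD1 w) /=; last by apply/eqP => /esym.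
rewrite big1 ?addr0; first by apply: eps_edge => //; exact: cov_card.
move=> c /andP[/eqP ne_cv /eqP ne_cw]; apply/eqP.
apply: contra_notT ne_cv => /eps_neq0 covc.
have [[i0 j0] r0 defc] := coversP _ _ covc; apply: T_inj; rewrite defc defv.
(* The vertices are graphs, so the edge has two elements in row i and one in
   every other row. *)
have [t tb] := meets_rows_card_eq (T_full v) (cov_card _ covv).
have [eq_i|ne_i] := eqVneq i0 i.
  subst i0; have [->//|ne_jj] := eqVneq j0 j.
  have : (i, j0) \in T v by rewrite defv !inE r0 andbT xpair_eqE eqxx.
  have : (i, j') \in T v by rewrite defv !inE Tij' andbT xpair_eqE eqxx.
  rewrite tb !mem_graph => /eqP -> /eqP eq_j.
  by case: ne_cw; apply: T_inj; rewrite defc defw eq_j.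
have := T_full c; rewrite defc => /meets_rowsD1_ex[j1 Tj1 ne_j1].
have : (i0, j1) \in T v by rewrite defv !inE Tj1 andbT xpair_eqE (negPf ne_i).
have : (i0, j0) \in T v by rewrite defv !inE r0 andbT xpair_eqE (negPf ne_i).
rewrite tb !mem_graph => /eqP eq_j0 /eqP eq_j1.
by rewrite -eq_j1 -eq_j0 eqxx in ne_j1.
Qed.

(** ** The strand of multidegree m *)

Definition bdk (z : C -> k) : C -> k := fun b' => \sum_b z b * (eps b b')%:~R.

Lemma bdkD z1 z2 b : bdk (fun b => z1 b + z2 b) b = bdk z1 b + bdk z2 b.
Proof. by rewrite /bdk -big_split; apply: eq_bigr => b' _; rewrite mulrDl. Qed.

Lemma bdkB z1 z2 b : bdk (fun b => z1 b - z2 b) b = bdk z1 b - bdk z2 b.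
Proof.
by rewrite /bdk -sumrB; apply: eq_bigr => b' _; rewrite mulrBl.
Qed.

Lemma bdk_bdk z b : bdk (bdk z) b = 0.
Proof.
rewrite /bdk; under eq_bigr do rewrite big_distrl /=.
rewrite exchange_big big1 // => b1 _.
under eq_bigr do rewrite -mulrA -rmorphM.
by rewrite -big_distrr -rmorph_sum /= eps_square_zero rmorph0 mulr0.
Qed.

Lemma bdk_neq0 z b' : bdk z b' != 0 ->
  exists b, z b != 0 /\ covers (T b) (T b').
Proof.
apply: contra_neqP => /forallNP all0; apply: big1 => b _.
apply/eqP; rewrite mulf_eq0; apply/contraT; rewrite negb_or => /andP[zb].
move=> ne0; case: (all0 b); split=> //; apply: eps_neq0.
by apply: contra ne0 => /eqP ->; rewrite rmorph0.
Qed.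

Definition in_strand (m : 'X_{1..n}) (h : nat) (z : C -> k) : Prop :=
  forall b, z b != 0 -> (cell_mnm (T b) <= m)%MM /\ #|T b| = h.

Lemma in_strand_bdk m h z : in_strand m h.+1 z -> in_strand m h (bdk z).
Proof.
move=> mz b' /bdk_neq0[b [/mz[le_bm card_b] /andP[sub /eqP card]]]; split.
  by apply: lepm_trans le_bm; apply: cell_mnmS.
by move: card; rewrite card_b => -[].
Qed.

Lemma neq0B (x y : k) : x - y != 0 -> x != 0 \/ y != 0.
Proof.
have [->|] := eqVneq x 0; last by left.
by rewrite sub0r oppr_eq0; right.
Qed.

Lemma neq0D (x y : k) : x + y != 0 -> x != 0 \/ y != 0.
Proof. by rewrite -[y]opprK => /neq0B; rewrite !oppr_eq0. Qed.

Lemma in_strandB m h z1 z2 : in_strand m h z1 -> in_strand m h z2 ->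
  in_strand m h (fun b => z1 b - z2 b).
Proof. by move=> m1 m2 b /neq0B[/m1|/m2]. Qed.

Lemma agree_sub (s : {ffun 'I_d -> 'I_n}) i (S S' : {set 'I_d * 'I_n}) :
  agree s i S -> S' \subset S -> meets_rows S' -> agree s i S'.
Proof.
move=> aS sub /meets_rowsP fS' i' j lt_i; apply/idP/eqP => [/(subsetP sub)|<-].
  by rewrite aS // => /eqP.
have [j' S'j'] := fS' i'; have := subsetP sub _ S'j'.
by rewrite aS // => /eqP ->.
Qed.

(** Pairing the cells of the strand that avoid (i, s i) with those containing
    it, a cycle supported on cells agreeing with s before row i is pushed,
    modulo a boundary, to cells agreeing with s up to row i. *)
Lemma push_row m s (i : 'I_d) h z : greedy m s -> in_strand m h z ->
    (forall b, bdk z b = 0) -> (forall b, z b != 0 -> agree s i (T b)) ->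
  exists g, in_strand m h.+1 g /\
    forall b, z b - bdk g b != 0 -> agree s i.+1 (T b).
Proof.
move=> gs mz bdz az; pose p := (i, s i).
pose g c := \sum_(b | (p \in T c) && (T b == T c :\ p)) z b * (eps c b)%:~R.
have gE c : g c != 0 ->
    exists b, [/\ z b != 0, p \in T c & T b = T c :\ p].
  apply: contra_neqP => /forallNP all0; apply: big1 => b /andP[pc /eqP eb].
  have [->|zb] := eqVneq (z b) 0; first by rewrite mul0r.
  by case: (all0 b).
have mg : in_strand m h.+1 g.
  move=> c /gE[b [zb pc eb]]; have [le_bm card_b] := mz b zb.
  have eq_c : T c = p |: T b by rewrite eb setD1K.
  have [_ le_cm] := inB_cell_add B_closed gs (T_inB b) le_bm (az b zb).
  by rewrite eq_c; split=> //; rewrite cardsU1 eb !inE eqxx -card_b eb.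
exists g; split=> //.
pose z' b := z b - bdk g b.
have mz' : in_strand m h z' by apply: in_strandB mz _; apply: in_strand_bdk.
have z'0 b : p \notin T b -> z' b = 0.
  move=> pb; rewrite /z'; suff -> : bdk g b = z b by rewrite subrr.
  have unique c : covers (T c) (T b) -> g c != 0 -> T b = T c :\ p.
    move=> /coversP[q qc eq_b] /gE[b0 [_ pc _]].
    by move: pb; rewrite eq_b !inE pc andbT negbK => /eqP ->.
  have [zb0|zb] := eqVneq (z b) 0.
    rewrite zb0; apply/eqP/contraT => /bdk_neq0[c [gc covc]].
    have eqb := unique c covc gc; have [b0 [zb0' _ eq_b0]] := gE c gc.
    by move: zb0'; rewrite (T_inj (etrans eq_b0 (esym eqb))) zb0 eqxx.
  have [le_bm _] := mz b zb.
  have [/T_onto[c eq_c] _] := inB_cell_add B_closed gs (T_inB b) le_bm (az b zb).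
  have covc : covers (T c) (T b).
    by apply/coversP; exists p; rewrite eq_c ?setU11 // setU1K.
  have gcE : g c = z b * (eps c b)%:~R.
    rewrite /g (eq_bigl (pred1 b)) ?big_pred1_eq // => b'.
    rewrite eq_c setU11 setU1K //=; apply/eqP/eqP => [/T_inj//|->//].
  rewrite /bdk (bigD1 c) //= big1 ?addr0.
    by rewrite gcE -mulrA eps_sqr // mulr1.
  move=> c' ne_c; apply/eqP; apply: contraT; rewrite mulf_eq0 negb_or.
  move=> /andP[gc' ne0]; case/eqP: ne_c; apply: T_inj.
  have covc' : covers (T c') (T b).
    by apply: eps_neq0; apply: contra ne0 => /eqP ->; rewrite rmorph0.
  have [_ [_ pc' _]] := gE c' gc'.
  by rewrite eq_c (unique _ covc' gc') setD1K.
have az' b : z' b != 0 -> agree s i (T b).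
  move=> /neq0B[/az//|/bdk_neq0[c [/gE[b0 [zb0 pc eb0]] /andP[sub _]]]].
  apply: agree_sub sub (T_full b) => i' j lt_i.
  rewrite -(az _ zb0) // eb0 !inE xpair_eqE; case: eqP => [eq_i|]//=.
  by rewrite eq_i ltnn in lt_i.
have bdz' b : bdk z' b = 0 by rewrite bdkB bdz bdk_bdk subr0.
move=> b; rewrite -/(z' b) => z'b; apply: agreeS (az' b z'b) _ => j.
have pb : p \in T b by apply: contraNT z'b => /z'0 ->.
apply/idP/eqP => [Tij|<-//]; apply/eqP; apply: contraT => ne_j.
have fU : meets_rows (T b :\ p) by apply: meets_rowsD1 Tij _; rewrite // eq_sym.
have [u eq_u] := sub_cell (subD1set _ _) fU.
have covb : covers (T b) (T u) by apply/coversP; exists p.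
have := bdz' u; rewrite /bdk (bigD1 b) //= big1 ?addr0.
  move/eqP; rewrite mulf_eq0 (negPf z'b) /= => /eqP eps0.
  by have := eps_sqr covb; rewrite eps0 mul0r => /esym/eqP; rewrite oner_eq0.
move=> c ne_cb; apply/eqP; apply: contraT; rewrite mulf_eq0 negb_or.
move=> /andP[z'c ne0]; case/eqP: ne_cb; apply: T_inj.
have pc : p \in T c by apply: contraNT z'c => /z'0 ->.
have /coversP[q qc] : covers (T c) (T u).
  by apply: eps_neq0; apply: contra ne0 => /eqP ->; rewrite rmorph0.
move=> eq_uc; have : p \notin T u by rewrite eq_u !inE eqxx.
rewrite eq_uc !inE pc andbT negbK => /eqP eq_pq.
by rewrite -(setD1K pc) -(setD1K pb) -eq_u eq_uc eq_pq.
Qed.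

Lemma push_all m s h z : greedy m s -> in_strand m h z ->
    (forall b, bdk z b = 0) ->
  exists g, in_strand m h.+1 g /\
    forall b, z b - bdk g b != 0 -> T b = graph s.
Proof.
move=> gs mz bdz.
suff: forall i, (i <= d)%N -> exists g, in_strand m h.+1 g /\
    forall b, z b - bdk g b != 0 -> agree s i (T b).
  move=> /(_ d (leqnn d))[g [mg ag]]; exists g; split=> // b /ag.
  exact: agree_max.
elim=> [|i IHi] lt_id.
  exists (fun=> 0); split=> [b|b _]; first by rewrite eqxx.
  exact: agree0.
have [g [mg ag]] := IHi (ltnW lt_id).
have mz' : in_strand m h (fun b => z b - bdk g b).
  by apply: in_strandB mz _; apply: in_strand_bdk.
have bdz' b : bdk (fun b => z b - bdk g b) b = 0.
  by rewrite bdkB bdz bdk_bdk subr0.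
have [g' [mg' ag']] := @push_row m s (Ordinal lt_id) h _ gs mz' bdz' ag.
exists (fun b => g b + g' b); split=> [b /neq0D[/mg|/mg']//|b].
by rewrite bdkD opprD addrA; apply: ag'.
Qed.

Lemma in_strand_deg m h z b : in_strand m h z -> z b != 0 -> (d <= mdeg m)%N.
Proof.
move=> mz /mz[le_bm _]; have [t tT] := transversal_exists (T_full b).
rewrite -(mdeg_transversal_mnm t) -cell_mnm_graph; apply: lepm_mdeg.
exact: lepm_trans (cell_mnmS tT) le_bm.
Qed.

Lemma bdk_edge_sum m g : in_strand m d.+1 g -> \sum_b bdk g b = 0.
Proof.
move=> mg; rewrite /bdk exchange_big big1 //= => b _.
rewrite -big_distrr -rmorph_sum /=.
have [->|/mg[_ cb]] := eqVneq (g b) 0; first by rewrite mul0r.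
by rewrite eps_edge_sum // rmorph0 mulr0.
Qed.

(** After pushing through all the rows, only the graph of s can survive. It is
    a vertex, so it is absent from cycles of positive degree, and in degree 0
    its coefficient is the augmentation of the cycle, boundaries of edges having
    augmentation zero. *)
Lemma strand_exact m h z : in_strand m h z -> (forall b, bdk z b = 0) ->
    (h = d -> \sum_b z b = 0) ->
  exists g, in_strand m h.+1 g /\ forall b, z b = bdk g b.
Proof.
move=> mz bdz sumz.
have [all0|/existsNP[b0 /eqP zb0]] := pselect (forall b, z b = 0).
  exists (fun=> 0); split=> [b|b]; first by rewrite eqxx.
  by rewrite all0 /bdk big1 // => b' _; rewrite mul0r.
have [s gs] := greedy_exists (in_strand_deg mz zb0).
have [g [mg zg]] := push_all gs mz bdz; exists g; split=> // b.
apply/eqP; rewrite -subr_eq0; apply: contraT => ne0.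
have card_b : #|T b| = d by rewrite (zg b ne0) card_graph.
have hd : h = d.
  by case/neq0B: (ne0) => [/mz|/(in_strand_bdk mg)] [_ <-].
subst h; have : \sum_c (z c - bdk g c) = 0.
  by rewrite sumrB sumz // (bdk_edge_sum mg) subr0.
rewrite (bigD1 b) //= big1 ?addr0 => [/eqP//|]; last first.
  move=> c ne_cb; apply/eqP; apply: contraT => /zg eq_c.
  by case/eqP: ne_cb; apply: T_inj; rewrite eq_c (zg b ne0).
by rewrite (negPf ne0).
Qed.


(** ** From strands to chains *)

Lemma mcoeffMX_le (f : {mpoly k[n]}) (u v : 'X_{1..n}) :
  (f * 'X_[u])@_v = if (u <= v)%MM then f@_(v - u) else 0.
Proof.
case: ifPn => [le_uv|nle_uv].
  by rewrite -{1}(submK le_uv) addmC mcoeffMX.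
apply/eqP; rewrite mcoeff_eq0 (perm_mem (msuppMX f u)); apply/mapP => -[w _].
by move=> eq_v; case/negP: nle_uv; rewrite eq_v lem_addr.
Qed.

Let CC := staircase_complex.

(** In multidegree m, a basis element b only occurs with the monomial
    m - cell_mnm (T b) as coefficient, and only if cell_mnm (T b) divides m. *)
Definition strand (m : 'X_{1..n}) (f : C -> {mpoly k[n]}) : C -> k :=
  fun b => if (cell_mnm (T b) <= m)%MM then (f b)@_(m - cell_mnm (T b)) else 0.

Definition lift_strand (m : 'X_{1..n}) (z : C -> k) : chain CC :=
  [ffun b : C => z b *: 'X_[(m - cell_mnm (T b))%MM]].

Lemma cell_mnm_covers b b' : eps b b' != 0 ->
  (cell_mnm (T b') <= cell_mnm (T b))%MM.
Proof. by move=> /eps_neq0/andP[sub _]; apply: cell_mnmS. Qed.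

Lemma bd_strand m (f : chain CC) b : strand m (bd f) b = bdk (strand m f) b.
Proof.
rewrite /strand /bdk; case: ifPn => [le_bm|nle_bm]; last first.
  apply/esym; apply: big1 => b' _; case: ifPn => [le_b'm|]; last by rewrite mul0r.
  have [->|/cell_mnm_covers le_bb'] := eqVneq (eps b' b) 0.
    by rewrite rmorph0 mulr0.
  by case/negP: nle_bm; apply: lepm_trans le_b'm.
rewrite /bd ffunE raddf_sum /=; apply: eq_bigr => b' _.
rewrite -scalerAr mcoeffZ mulrC.
have [->|/cell_mnm_covers le_bb'] := eqVneq (eps b' b) 0.
  by rewrite rmorph0 !mulr0.
rewrite mcoeffMX_le; congr (_ * _).
have -> : (cell_mnm (T b') - cell_mnm (T b) <= m - cell_mnm (T b))%MM
    = (cell_mnm (T b') <= m)%MM.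
  apply/mnm_lepP/mnm_lepP => H i; move: (H i); rewrite !mnmBE.
    by move: (mnm_lepP le_bm i) (mnm_lepP le_bb' i); lia.
  by move: (mnm_lepP le_bm i) (mnm_lepP le_bb' i); lia.
case: ifP => // le_b'm; congr mcoeff; apply/mnmP => i; rewrite !mnmBE.
by move: (mnm_lepP le_bm i) (mnm_lepP le_bb' i) (mnm_lepP le_b'm i); lia.
Qed.

Lemma bd_lift m h z : in_strand m h z ->
  bd (lift_strand m z) = lift_strand m (bdk z).
Proof.
move=> mz; apply/ffunP => b'; rewrite !ffunE scaler_suml; apply: eq_bigr => b _.
rewrite ffunE -scalerAl -scalerAr scalerA.
have [->|/mz[le_bm _]] := eqVneq (z b) 0; first by rewrite !mul0r !scale0r.
have [->|/cell_mnm_covers le_b'b] := eqVneq (eps b b') 0.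
  by rewrite rmorph0 mulr0 !scale0r.
rewrite -mpolyXD; congr (_ *: 'X_[_]); apply/mnmP => i; rewrite mnmDE !mnmBE.
by move: (mnm_lepP le_bm i) (mnm_lepP le_b'b i); lia.
Qed.

Lemma sum_strands (f : chain CC) (D : nat) :
    (forall b, (msize (f b) + mdeg (cell_mnm (T b)) <= D)%N) ->
  f = \sum_(m : 'X_{1..n < D}) lift_strand m (strand m f).
Proof.
move=> leD; apply/ffunP => b; apply/mpolyP => u; rewrite sum_ffunE raddf_sum /=.
under eq_bigr => m _ do rewrite ffunE mcoeffZ mcoeffX.
have term0 (m : 'X_{1..n < D}) : m != (u + cell_mnm (T b))%MM :> 'X_{1..n} ->
    strand m f b * ((m - cell_mnm (T b))%MM == u)%:R = 0.
  move=> ne_m; rewrite /strand; case: ifP => [le_bm|]; last by rewrite mul0r.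
  case: eqP => [eq_u|]; last by rewrite mulr0.
  by case/eqP: ne_m; rewrite -eq_u submK.
have [fu|fu] := eqVneq ((f b)@_u) 0.
  rewrite fu big1 // => m _.
  have [eq_m|/term0//] := eqVneq (bmnm m) (u + cell_mnm (T b))%MM.
  by rewrite /strand eq_m lem_addl addmK fu mul0r.
have lt_uD : (mdeg (u + cell_mnm (T b)) < D)%N.
  apply: leq_trans (leD b); rewrite mdegD -addSn leq_add2r.
  by apply: msize_mdeg_lt; rewrite mcoeff_msupp.
rewrite (bigD1 (BMultinom lt_uD)) //= big1 ?addr0 => [|m ne_m].
  by rewrite /strand /= lem_addl addmK eqxx mulr1.
by apply: term0; apply: contra ne_m => /eqP eq_m; apply/eqP/val_inj.
Qed.

Lemma strand_in_strand m h (f : chain CC) :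
  @in_hdeg k n CC h f -> in_strand m (h + d) (strand m f).
Proof.
move=> fh b; rewrite /strand; case: ifP => [le_bm ne0|]; last by rewrite eqxx.
split=> //; have : f b != 0 by apply: contraNneq ne0 => ->; rewrite mcoeff0.
by move=> /fh /= <-; rewrite subnK.
Qed.

Lemma bd_sum (I : finType) (F : I -> chain CC) :
  bd (\sum_i F i : chain CC) = \sum_i bd (F i).
Proof.
apply/ffunP => b; rewrite sum_ffunE ffunE.
under [RHS]eq_bigr do rewrite ffunE.
rewrite exchange_big; apply: eq_bigr => b' _.
by rewrite sum_ffunE big_distrl.
Qed.

Lemma chain_exact h (f : chain CC) : @in_hdeg k n CC h f -> bd f = 0 ->
    (h = 0%N -> forall m, \sum_b strand m f b = 0) ->
  exists g : chain CC, @in_hdeg k n CC h.+1 g /\ bd g = f.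
Proof.
move=> fh bdf0 sum0.
have /boolp.choice[g gP] (m : 'X_{1..n}) :
    exists g, in_strand m (h + d).+1 g /\ forall b, strand m f b = bdk g b.
  apply: strand_exact => [|b|hd]; first exact: strand_in_strand.
    rewrite -bd_strand bdf0 /strand; case: ifP => // _.
    by rewrite ffunE mcoeff0.
  by apply: sum0; move: hd; lia.
pose D := (\max_b (msize (f b) + mdeg (cell_mnm (T b))))%N.
exists (\sum_(m : 'X_{1..n < D}) lift_strand m (g m)); split.
  move=> b; rewrite sum_ffunE => ne0 /=.
  have [m ne0m] : exists m : 'X_{1..n < D}, lift_strand m (g m) b != 0.
    apply: contrapT => /forallNP all0; case/eqP: ne0; apply: big1 => m _.
    by apply/eqP; rewrite -[X in is_true X]negbK; apply/negP.
  have : g m b != 0 by apply: contraNneq ne0m => g0; rewrite ffunE g0 scale0r.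
  by case: (gP m) => mg _ /mg[_ ->]; lia.
rewrite bd_sum [RHS](@sum_strands f D) => [|b]; last first.
  exact: (@leq_bigmax _ (fun b => msize (f b) + mdeg (cell_mnm (T b)))%N).
apply: eq_bigr => m _; have [mg eqg] := gP m.
rewrite (bd_lift mg); apply/ffunP => b; rewrite !ffunE.
by rewrite eqg.
Qed.

Lemma staircase_is_complex : is_complex CC.
Proof.
split=> [b b'|b b' m|f b2] /=.
- move=> ne0; have /andP[_ /eqP ->] : covers (T b) (T b').
    by apply: eps_neq0; apply: contraNneq ne0 => ->; rewrite rmorph0 scale0r.
  by rewrite subSn.
- rewrite mcoeffZ mcoeffX; case: (_ =P m) => [<-|_]; last by rewrite mulr0 eqxx.
  move=> ne0; rewrite submK //; apply: cell_mnm_covers.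
  by apply: contraNneq ne0 => ->; rewrite rmorph0 mul0r.
- rewrite ffunE; under eq_bigr do rewrite ffunE big_distrl /=.
  rewrite exchange_big big1 //= => b _.
  under eq_bigr do rewrite -mulrA; rewrite -big_distrr /=.
  rewrite (eq_bigr (fun b1 => (eps b b1 * eps b1 b2)%:~R *:
      'X_[(cell_mnm (T b) - cell_mnm (T b2))%MM])); last first.
    move=> b1 _; rewrite -scalerAl -scalerAr scalerA -rmorphM -mpolyXD.
    have [->|/cell_mnm_covers le1] := eqVneq (eps b b1) 0.
      by rewrite mul0r rmorph0 !scale0r.
    have [->|/cell_mnm_covers le2] := eqVneq (eps b1 b2) 0.
      by rewrite mulr0 rmorph0 !scale0r.
    congr (_ *: 'X_[_]); apply/mnmP => i; rewrite mnmDE !mnmBE.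
    by move: (mnm_lepP le1 i) (mnm_lepP le2 i); lia.
  by rewrite -scaler_suml -rmorph_sum eps_square_zero rmorph0 scale0r mulr0.
Qed.

(** Only its values on vertices matter, where it is the inclusion of the
    generators of the ideal. *)
Definition vertex_aug (b : C) : {mpoly k[n]} := 'X_[cell_mnm (T b)].

Lemma ev_strand (f : chain CC) m :
  (@ev k n CC vertex_aug f)@_m = \sum_b strand m f b.
Proof. by rewrite /ev raddf_sum; apply: eq_bigr => b _; rewrite /vertex_aug /= mcoeffMX_le. Qed.

Lemma in_hdeg0_bd (f : chain CC) : @in_hdeg k n CC 0 f -> bd f = 0.
Proof.
move=> f0; apply/ffunP => b; rewrite !ffunE big1 // => b' _ /=.
have [->|/f0 /= cb'] := eqVneq (f b') 0; first by rewrite mul0r.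
rewrite eps_zero ?rmorph0 ?scale0r ?mulr0 //; apply/negP => /andP[_ /eqP].
by move=> eq_c; move: cb'; rewrite eq_c subSn ?T_card.
Qed.

Lemma ev_bd (g : chain CC) : @in_hdeg k n CC 1 g -> @ev k n CC vertex_aug (bd g) = 0.
Proof.
move=> g1; apply/mpolyP => m; rewrite mcoeff0 ev_strand.
under eq_bigr do rewrite bd_strand.
exact: bdk_edge_sum (strand_in_strand (m := m) g1).
Qed.

Lemma vertex_in_B b : (#|T b| <= d)%N -> B (cell_mnm (T b)).
Proof.
move=> le_d; have [_ _ BT] := T_inB b.
have [|s eq_s] := meets_rows_card_eq (T_full b).
  by apply/eqP; rewrite eqn_leq le_d T_card.
by rewrite eq_s cell_mnm_graph; apply: BT; rewrite eq_s.
Qed.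

Lemma vertex_of_B m : B m -> exists b, #|T b| = d /\ cell_mnm (T b) = m.
Proof.
move=> Bm; have [s Bs <-] := greedy_cell Bm (B_deg Bm).
have [b eq_b] := T_onto Bs.
by exists b; rewrite eq_b card_graph cell_mnm_graph.
Qed.

Lemma image_ev :
  monomials_ideal k B = [set @ev k n CC vertex_aug f | f in @in_hdeg k n CC 0]%classic.
Proof.
apply/seteqP; split=> [p Bp|_ [f f0 <-]].
  apply: Bp; split; first split.
  - exists [ffun=> 0]; first by move=> b; rewrite ffunE eqxx.
    by rewrite /ev big1 // => b _; rewrite ffunE mul0r.
  - move=> _ _ [f f0 <-] [g g0 <-]; exists (f + g).
      move=> b; rewrite ffunE; have [->|/f0//] := eqVneq (f b) 0.
      by rewrite add0r => /g0.
    by rewrite /ev -big_split; apply: eq_bigr => b _; rewrite ffunE mulrDl.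
  - move=> p' _ [f f0 <-]; exists [ffun b => p' * f b].
      move=> b; rewrite ffunE; have [->|/f0//] := eqVneq (f b) 0.
      by rewrite mulr0 eqxx.
    by rewrite /ev big_distrr; apply: eq_bigr => b _; rewrite ffunE /= -mulrA.
  - move=> _ [m /vertex_of_B[b [card_b eq_m]] <-].
    exists [ffun b' : C => (b' == b)%:R].
      move=> b'; rewrite ffunE /=; case: (_ =P b) => [->|]; last by rewrite eqxx.
      by rewrite card_b subnn.
    rewrite /ev (bigD1 b) //= big1 => [|b' /negPf ne_b].
      by rewrite ffunE eqxx mul1r addr0 /vertex_aug eq_m.
    by rewrite ffunE ne_b mul0r.
apply: ideal_sum; first exact: monomials_ideal_ideal.
move=> b _; have [->|/f0 /= hb] := eqVneq (f b) 0.
  by rewrite mul0r; have [] := monomials_ideal_ideal k B.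
have [_ _] := monomials_ideal_ideal k B; apply.
apply/monomials_idealX; exists (cell_mnm (T b)); last exact: lepm_refl.
by apply: vertex_in_B; rewrite -subn_eq0 hb.
Qed.

(** No choice of signs is involved: exactness only uses that the incidences of
    facets are units and that the differential squares to zero. *)
Theorem staircase_resolution : free_resolution CC (monomials_ideal k B).
Proof.
split; first exact: staircase_is_complex.
exists vertex_aug; split=> [b m _|||h f fh bdf0].
- by rewrite mcoeffX; case: (_ =P m) => [<-|]; rewrite ?eqxx.
- exact: image_ev.
- move=> f f0; split=> [evf0|[g [g1 <-]]]; last exact: ev_bd.
  apply: chain_exact f0 (in_hdeg0_bd f0) _ => _ m.
  by rewrite -ev_strand evf0 mcoeff0.
- apply: chain_exact fh _ _ => //.
Qed.

(** A facet is obtained by removing some (i, j), and its coefficient is a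
    multiple of the variable j. *)
Theorem staircase_minimal : minimal_complex CC.
Proof.
move=> f b; rewrite ffunE raddf_sum big1 //= => b' _.
have [->|/eps_neq0/coversP[p pS eq_b]] := eqVneq (eps b' b) 0.
  by rewrite rmorph0 scale0r mulr0 mcoeff0.
rewrite -scalerAr mcoeffZ mcoeffMX_le; case: ifP => [/mnm_lepP/(_ p.2)|].
  rewrite mnmBE mnm0E -(setD1K pS) cell_mnmU1 ?inE ?eqxx // mnmDE mnm1E eqxx.
  by rewrite eq_b addnK.
by rewrite mulr0.
Qed.

End Resolution.

(** * The cell of a staircase *)

Section Cells.
Import fintype mathcomp.boot.finset.
Variables (R : realType) (d n : nat).
Implicit Types (T : {set 'I_d * 'I_n}) (s : {ffun 'I_d -> 'I_n}).
Implicit Types (w : 'M[R]_(d, n)) (x c : 'rV[R]_n).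

Definition weights T w : Prop :=
  [/\ forall i j, 0 <= w i j, forall i, \sum_j w i j = 1
    & forall i j, w i j != 0 -> (i, j) \in T].

(** The rows of w are points of the d summands, and this is their sum. *)
Definition colsum w : 'rV[R]_n := \row_j \sum_i w i j.

Definition cellof T : set 'rV[R]_n :=
  [set x | exists2 w, weights T w & x = colsum w]%classic.

Lemma weightsS T T' w : T' \subset T -> weights T' w -> weights T w.
Proof.
move=> /subsetP sub [w0 w1 wT]; split=> // i j /wT; exact: sub.
Qed.

Lemma cellofS T T' : T' \subset T -> (cellof T' `<=` cellof T)%classic.
Proof. by move=> sub x [w /(weightsS sub) ww ->]; exists w. Qed.

Lemma dotp0l x : dotp 0 x = 0.
Proof. by rewrite /dotp big1 // => j _; rewrite mxE mul0r. Qed.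

Lemma dotpBl c c' x : dotp (c - c') x = dotp c x - dotp c' x.
Proof. by rewrite /dotp -sumrB; apply: eq_bigr => j _; rewrite !mxE mulrBl. Qed.

Lemma dotpBr c x x' : dotp c (x - x') = dotp c x - dotp c x'.
Proof. by rewrite /dotp -sumrB; apply: eq_bigr => j _; rewrite !mxE mulrBr. Qed.

Lemma dotp_colsum c w : dotp c (colsum w) = \sum_i \sum_j c 0 j * w i j.
Proof.
rewrite /dotp exchange_big; apply: eq_bigr => j _.
by rewrite mxE big_distrr.
Qed.

(** ** Uniqueness of the sorted decomposition *)

Definition prefix_sum w (p q : nat) : R :=
  \sum_(i < d | (i < p)%N) \sum_(j < n | (j < q)%N) w i j.

(** An element in the upper right corner and another one in the lower left corner
    would violate the chain condition. *)
Lemma staircase_split T (p q : nat) : staircase T ->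
  (forall i j, (i, j) \in T -> (i < p)%N -> (j < q)%N) \/
  (forall i j, (i, j) \in T -> (p <= i)%N -> (q <= j)%N).
Proof.
move=> /staircaseP sT.
have [|/existsNP[i /existsNP[j]]] :=
  pselect (forall i j, (i, j) \in T -> (i < p)%N -> (j < q)%N); first by left.
move=> /not_implyP[Tij /not_implyP[lt_ip nlt_jq]]; right=> i' j' Tij' le_pi'.
by have := sT _ _ _ _ Tij Tij' (leq_trans lt_ip le_pi'); lia.
Qed.

Lemma prefix_sum_rows T w (p q : nat) : weights T w ->
    (forall i j, (i, j) \in T -> (i < p)%N -> (j < q)%N) ->
  prefix_sum w p q = \sum_(i < d | (i < p)%N) 1.
Proof.
move=> [_ w1 wT] H; apply: eq_bigr => i lt_ip.
rewrite -[RHS](w1 i) [LHS]big_mkcond; apply: eq_bigr => j _.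
case: ifPn => // nlt; apply/esym/eqP; apply: contraNT nlt => /wT Tij.
exact: H Tij lt_ip.
Qed.

Lemma prefix_sum_cols T w (p q : nat) : weights T w ->
    (forall i j, (i, j) \in T -> (p <= i)%N -> (q <= j)%N) ->
  prefix_sum w p q = \sum_(j < n | (j < q)%N) colsum w 0 j.
Proof.
move=> [_ _ wT] H; rewrite /prefix_sum big_mkcond /=.
under [RHS]eq_bigr do rewrite mxE; rewrite exchange_big.
apply: eq_bigr => i _; case: ifPn => // nlt; apply/esym/big1 => j lt_jq.
apply/eqP; apply: contraT => /wT Tij.
by have := H _ _ Tij; lia.
Qed.

Lemma prefix_sum_le T w (p q : nat) : weights T w ->
  prefix_sum w p q <= \sum_(i < d | (i < p)%N) 1 /\
  prefix_sum w p q <= \sum_(j < n | (j < q)%N) colsum w 0 j.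
Proof.
move=> [w0 w1 _]; split.
  apply: ler_sum => i _; rewrite -(w1 i) [leRHS](bigID (fun j : 'I_n => j < q)%N).
  by rewrite /= lerDl sumr_ge0.
under [leRHS]eq_bigr do rewrite mxE; rewrite exchange_big /=.
rewrite [leRHS](bigID (fun i : 'I_d => i < p)%N) /= lerDl sumr_ge0 // => i _.
exact: sumr_ge0.
Qed.

(** The sum of a corner block of the weights is the smaller of the number of
    rows and of the sum of columns that the block spans, so it is determined
    by the point. *)
Lemma prefix_sum_min T w (p q : nat) : staircase T -> weights T w ->
  prefix_sum w p q = Num.min (\sum_(i < d | (i < p)%N) 1)
                             (\sum_(j < n | (j < q)%N) colsum w 0 j).
Proof.
move=> sT ww; have [le1 le2] := prefix_sum_le p q ww.
have [H|H] := staircase_split p q sT.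
  have eq1 := prefix_sum_rows ww H.
  by rewrite minElt -eq1; case: ltP => // ge2; apply: le_anti; rewrite le2 ge2.
have eq2 := prefix_sum_cols ww H.
by rewrite -eq2 minElt; case: ltP => // lt1; rewrite leNgt lt1 in le1.
Qed.

Lemma weight_prefix w (i : 'I_d) (j : 'I_n) :
  w i j = prefix_sum w i.+1 j.+1 - prefix_sum w i j.+1
          - (prefix_sum w i.+1 j - prefix_sum w i j).
Proof.
have ltS m (l : 'I_m) (F : 'I_m -> R) : \sum_(k < m | (k < l.+1)%N) F k
    = F l + \sum_(k < m | (k < l)%N) F k.
  rewrite (bigD1 l) //=; congr (_ + _); apply: eq_bigl => k.
  by rewrite ltnS ltn_neqAle andbC.
have rowS q : prefix_sum w i.+1 q - prefix_sum w i q = \sum_(j < n | (j < q)%N) w i j.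
  by rewrite /prefix_sum ltS addrK.
by rewrite !rowS ltS addrK.
Qed.

(** Two staircases are allowed, so that this also computes intersections of
    cells. *)
Lemma weights_unique T T' w w' : staircase T -> staircase T' ->
  weights T w -> weights T' w' -> colsum w = colsum w' -> w = w'.
Proof.
move=> sT sT' ww ww' eqx; apply/matrixP => i j.
by rewrite 2!weight_prefix !(prefix_sum_min _ _ sT ww)
           !(prefix_sum_min _ _ sT' ww') eqx.
Qed.

Definition affine_on T (phi : 'M[R]_(d, n) -> R) : Prop :=
  exists c b, forall w, weights T w -> phi w = dotp c (colsum w) + b.

Lemma affine_onB T phi psi : affine_on T phi -> affine_on T psi ->
  affine_on T (fun w => phi w - psi w).
Proof.
move=> [c [b phiE]] [c' [b' psiE]]; exists (c - c'), (b - b') => w ww.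
by rewrite phiE // psiE // dotpBl opprD addrACA.
Qed.

Lemma affine_prefix_sum T (p q : nat) : staircase T ->
  affine_on T (fun w => prefix_sum w p q).
Proof.
move=> sT; have [H|H] := staircase_split p q sT.
  exists 0, (\sum_(i < d | (i < p)%N) 1) => w ww.
  by rewrite (prefix_sum_rows ww H) dotp0l add0r.
exists (\row_j (j < q)%:R), 0 => w ww; rewrite (prefix_sum_cols ww H) addr0 /dotp.
rewrite big_mkcond; apply: eq_bigr => j _; rewrite [X in _ = X * _]mxE.
by case: ifP; rewrite ?mul1r ?mul0r.
Qed.

(** According to the alternative in staircase_split, a corner sum is constant or
    a sum of coordinates of the point, and a single weight is an alternating sum
    of four corner sums. *)
Lemma affine_weight T i j : staircase T -> affine_on T (fun w => w i j).
Proof.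
move=> sT; suff [c [b cb]] : affine_on T (fun w =>
    prefix_sum w i.+1 j.+1 - prefix_sum w i j.+1
          - (prefix_sum w i.+1 j - prefix_sum w i j)).
  by exists c, b => w ww; rewrite weight_prefix cb.
by do !apply: affine_onB; apply: affine_prefix_sum.
Qed.

(** ** Transversals as points *)

Definition indic s : 'M[R]_(d, n) := \matrix_(i, j) (s i == j)%:R.

Lemma weights_indic s T : graph s \subset T -> weights T (indic s).
Proof.
move=> /graphP sT; split=> [i j|i|i j]; rewrite ?mxE ?ler0n //.
  rewrite (bigD1 (s i)) //= mxE eqxx big1 ?addr0 // => j /negPf ne.
  by rewrite mxE eq_sym ne.
by case: (s i =P j) => [<-|]; rewrite ?eqxx.
Qed.

Lemma colsum_indic s : colsum (indic s) = expv R (transversal_mnm s).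
Proof.
apply/rowP => j; rewrite !mxE transversal_mnmE -sum1_card natr_sum.
rewrite [RHS]big_mkcond; apply: eq_bigr => i _.
by rewrite mxE inE; case: eqP.
Qed.

Lemma weights_graph s w : weights (graph s) w -> w = indic s.
Proof.
move=> [_ w1 wT]; apply/matrixP => i j; rewrite mxE.
have w0 j' : j' != s i -> w i j' = 0.
  move=> ne; apply/eqP; apply: contraNT ne => /wT.
  by rewrite mem_graph eq_sym.
case: eqP => [<-|/eqP ne]; last by apply: w0; rewrite eq_sym.
by rewrite -[RHS](w1 i) (bigD1 (s i)) //= big1 ?addr0.
Qed.

Lemma cellof_graph s : cellof (graph s) = [set expv R (transversal_mnm s)]%classic.
Proof.
apply/seteqP; split=> [x [w /weights_graph -> ->]|_ ->].
  by rewrite colsum_indic.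
by exists (indic s); [exact: weights_indic|rewrite colsum_indic].
Qed.

Lemma expv_transversal s T : graph s \subset T ->
  cellof T (expv R (transversal_mnm s)).
Proof. by move=> /cellofS; apply; rewrite cellof_graph. Qed.

Lemma cellof_nonempty T : (cellof T !=set0)%classic <-> meets_rows T.
Proof.
split=> [[x [w [_ w1 wT] _]]|/transversal_exists[s sT]]; last first.
  by exists (expv R (transversal_mnm s)); exact: expv_transversal.
apply/meets_rowsP => i; apply: contrapT => /forallNP nT.
have := w1 i; rewrite big1 => [/esym/eqP|j _]; first by rewrite oner_eq0.
by apply/eqP; apply: contraT => /wT /nT.
Qed.

Lemma cellof_empty T : ~~ meets_rows T -> cellof T = classical_sets.set0.
Proof.
move=> /negP nT; apply/seteqP; split=> // x cx; case: nT.
by apply/cellof_nonempty; exists x.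
Qed.

Lemma cellof_sub T T' : staircase T -> staircase T' -> meets_rows T ->
  (cellof T `<=` cellof T')%classic -> T \subset T'.
Proof.
move=> sT sT' fT sub; apply/subsetP => -[i j] Tij.
have [s ss eq_j] := transversal_through fT Tij.
have [w ww eqx] := sub _ (expv_transversal ss).
have ws := weights_indic ss; rewrite -colsum_indic in eqx.
have eqw := weights_unique sT sT' ws ww eqx.
case: ww => _ _; apply; rewrite -eqw mxE eq_j eqxx.
exact: oner_neq0.
Qed.

Lemma cellof_inj T T' : staircase T -> staircase T' ->
  meets_rows T -> meets_rows T' -> cellof T = cellof T' -> T = T'.
Proof.
move=> sT sT' fT fT' eqT; apply/eqP; rewrite eqEsubset.
by apply/andP; split; apply: cellof_sub => //; rewrite eqT.
Qed.

Lemma cellofI T T' : staircase T -> staircase T' ->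
  (cellof T `&` cellof T')%classic = cellof (T :&: T').
Proof.
move=> sT sT'; apply/seteqP; split=> [x [[w ww ->] [w' ww' eqx]]|x cx].
  have eqw := weights_unique sT sT' ww ww' eqx; subst w'; exists w => //.
  case: ww ww' => [w0 w1 wT] [_ _ wT']; split=> // i j ne0.
  by rewrite inE wT // wT'.
by split; apply: cellofS cx; rewrite ?subsetIl ?subsetIr.
Qed.

(** ** Faces *)

(** The functional is minus the total weight put outside T', which is affine on
    the cell by affine_weight. *)
Lemma face_cellof T T' : staircase T -> T' \subset T ->
  face (cellof T) (cellof T').
Proof.
move=> sT sub; pose D := enum (T :\: T').
have [c [b cb]] : affine_on T (fun w => - \sum_(p <- D) w p.1 p.2).
  elim: D => [|p r IHr].
    by exists 0, 0 => w _; rewrite big_nil oppr0 dotp0l addr0.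
  have [c [b cb]] := affine_onB IHr (affine_weight p.1 p.2 sT).
  by exists c, b => w ww; rewrite -cb // big_cons opprD addrC.
have {}cb w : weights T w ->
    dotp c (colsum w) = - b - \sum_(p in T :\: T') w p.1 p.2.
  move=> ww; rewrite -[X in _ - X]big_enum /= [- b - _]addrC cb //.
  by rewrite addrK.
have cb_eq w : weights T w ->
    (dotp c (colsum w) = - b <-> \sum_(p in T :\: T') w p.1 p.2 = 0).
  move=> ww; rewrite cb //; split=> [/eqP|->]; last by rewrite subr0.
  by rewrite -subr_eq0 addrAC subrr sub0r oppr_eq0 => /eqP.
exists c, (- b); split.
  by move=> x [w ww ->]; rewrite cb // gerBl sumr_ge0 // => p _; case: ww.
apply/seteqP; split=> [x [w ww ->]|x [[w ww ->] /(cb_eq _ ww) sum0]].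
  have wwT := weightsS sub ww; split; first by exists w.
  apply/cb_eq => //; apply: big1 => -[i j]; rewrite inE => /andP[nT' _].
  by apply/eqP; apply: contraNT nT'; case: ww => _ _; apply.
exists w => //; case: (ww) => [w0 w1 wT]; split=> // i j ne0.
apply: contraNT ne0 => nT'; have [Tij|nTij] := boolP ((i, j) \in T); last first.
  by apply: contraNT nTij; apply: wT.
have /= := psumr_eq0P (fun p _ => w0 p.1 p.2) sum0 (i := (i, j)).
by rewrite inE nT' Tij => -> //.
Qed.

Lemma dotp_expv c s : dotp c (expv R (transversal_mnm s)) = \sum_i c 0 (s i).
Proof.
rewrite -colsum_indic dotp_colsum; apply: eq_bigr => i _.
rewrite (bigD1 (s i)) //= mxE eqxx mulr1 big1 ?addr0 // => j /negPf ne.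
by rewrite mxE eq_sym ne mulr0.
Qed.

(** A linear functional is maximal on a sum of simplices exactly where each
    summand only uses vertices maximizing the functional in its row. *)
Lemma face_cellof_inv T F : meets_rows T -> face (cellof T) F ->
  F = classical_sets.set0 \/ exists T', [/\ T' \subset T, meets_rows T' & F = cellof T'].
Proof.
move=> fT [c [b [leb ->]]]; set F' := (X in X = _ \/ _).
have [->|/classical_sets.set0P[x0 [[w0 ww0 eqx0] eqb]]] := eqVneq F' classical_sets.set0; first by left.
right; pose T' := [set p in T | [forall j, ((p.1, j) \in T) ==> (c 0 j <= c 0 p.2)]].
have sub : T' \subset T by apply/subsetP => p; rewrite inE => /andP[].
have maxT' i j j' : (i, j) \in T' -> (i, j') \in T -> c 0 j' <= c 0 j.
  by rewrite inE => /andP[_ /forallP/(_ j')/implyP]; apply.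
have fT' : meets_rows T'.
  apply/meets_rowsP => i; have [j Tij] := meets_rowsP _ fT i.
  pose P j' := (i, j') \in T.
  have [j' Pj' maxj'] : exists2 j', P j' & forall j0, P j0 -> c 0 j0 <= c 0 j'.
    by exists [arg max_(j' > j | P j') c 0 j']%O; case: arg_maxP.
  by exists j'; rewrite inE [_ \in T]Pj' /=; apply/forallP => j0; apply/implyP/maxj'.
have [s sT'] := transversal_exists fT'; have ss := graphP _ _ sT'.
exists T'; split=> //.
have defect w : weights T w -> b - dotp c (colsum w)
    = b - \sum_i c 0 (s i) + \sum_i \sum_j w i j * (c 0 (s i) - c 0 j).
  move=> [_ w1 _]; rewrite dotp_colsum -addrA; congr (_ + _).
  rewrite -sumrN -sumrN -big_split; apply: eq_bigr => i _ /=.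
  under [X in _ = _ + X]eq_bigr do rewrite mulrBr.
  rewrite sumrB -big_distrl /= w1 mul1r addKr; congr (- _).
  by apply: eq_bigr => j _; rewrite mulrC.
have term_ge0 w : weights T w ->
    forall i j, 0 <= w i j * (c 0 (s i) - c 0 j).
  move=> [wp _ wT] i j; have [->|/wT Tij] := eqVneq (w i j) 0.
    by rewrite mul0r.
  by rewrite mulr_ge0 // subr_ge0; apply: maxT' (ss i) Tij.
have sum_ge0 w : weights T w ->
    0 <= \sum_i \sum_j w i j * (c 0 (s i) - c 0 j).
  by move=> ww; do 2!apply: sumr_ge0 => ? _; apply: term_ge0.
have eqM : b = \sum_i c 0 (s i).
  apply/eqP; rewrite eq_le; apply/andP; split; last first.
    by rewrite -dotp_expv; apply/leb/expv_transversal/(subset_trans sT').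
  rewrite -subr_le0 -[leLHS](addrK (\sum_i \sum_j w0 i j * (c 0 (s i) - c 0 j))).
  by rewrite -defect // -eqx0 eqb subrr sub0r oppr_le0 sum_ge0.
have {}defect w : weights T w -> (dotp c (colsum w) = b <->
    \sum_i \sum_j w i j * (c 0 (s i) - c 0 j) = 0).
  move=> /defect; rewrite -eqM subrr add0r => <-.
  by split=> [->|/eqP]; rewrite ?subrr // subr_eq0 => /eqP.
apply/seteqP; split=> [x [[w ww ->] /(defect _ ww)]|x [w ww ->]].
  move=> sum0; exists w => //; case: (ww) => [wp w1 wT]; split=> // i j ne0.
  have : \sum_j w i j * (c 0 (s i) - c 0 j) = 0.
    apply: (psumr_eq0P _ sum0) => // i' _.
    by apply: sumr_ge0 => j' _; apply: term_ge0.
  move=> sumi0; have eq0 : w i j * (c 0 (s i) - c 0 j) = 0.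
    by apply: (psumr_eq0P _ sumi0) => // j' _; apply: term_ge0.
  move/eqP: eq0; rewrite mulf_eq0 (negPf ne0) /= subr_eq0 => /eqP eq_c.
  rewrite inE wT //=; apply/forallP => j'; apply/implyP => /(maxT' _ _ _ (ss i)).
  by rewrite eq_c.
have wwT := weightsS sub ww; split; first by exists w.
apply/defect => //; apply: big1 => i _; apply: big1 => j _.
have [->|ne0] := eqVneq (w i j) 0; first by rewrite mul0r.
case: ww => [_ _ /(_ i j ne0) T'ij].
suff -> : c 0 (s i) = c 0 j by rewrite subrr mulr0.
by apply: le_anti; apply/andP; split; apply: (maxT' i) => //; apply: (subsetP sub).
Qed.

Lemma cellof_vertices T v : staircase T -> meets_rows T ->
  vertices (cellof T) v <->
  exists2 s, graph s \subset T & v = expv R (transversal_mnm s).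
Proof.
move=> sT fT; split=> [/(face_cellof_inv fT)[eqv|[T' [sub fT' eqv]]]|[s sub ->]].
- by have : classical_sets.set0 v by rewrite -eqv.
- have [s sT'] := transversal_exists fT'.
  exists s; first exact: subset_trans sub.
  have : [set v]%classic (expv R (transversal_mnm s)).
    by rewrite eqv; apply: expv_transversal.
  by move=> ->.
- by rewrite /vertices /= -cellof_graph; apply: face_cellof.
Qed.

(** ** Dimension *)

Lemma colsum_shift T s w : weights T w -> colsum w = expv R (transversal_mnm s)
  + \sum_(q in T :\: graph s) w q.1 q.2 *: (delta_mx 0 q.2 - delta_mx 0 (s q.1)).
Proof.
move=> [_ w1 wT].
rewrite -colsum_indic; apply/rowP => l; rewrite !mxE summxE.
have -> : \sum_(q in T :\: graph s)
     (w q.1 q.2 *: (delta_mx 0 q.2 - delta_mx 0 (s q.1)) : 'rV[R]_n) 0 l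
  = \sum_q w q.1 q.2 * ((l == q.2)%:R - (l == s q.1)%:R).
  rewrite big_mkcond; apply: eq_bigr => -[i j] _; rewrite !mxE !eqxx /=.
  case: ifPn => //; rewrite !inE negb_and negbK /= => /orP[/eqP ->|nT].
    by rewrite subrr mulr0.
  have -> : w i j = 0 by apply/eqP; apply: contraNT nT => /wT.
  by rewrite mul0r.
rewrite -(pair_big xpredT xpredT
  (fun i j => w i j * ((l == j)%:R - (l == s i)%:R))) /= -big_split /=.
apply: eq_bigr => i _; under [X in _ = _ + X]eq_bigr do rewrite mulrBr.
rewrite sumrB -big_distrl /= w1 mul1r mxE [s i == l]eq_sym addrCA subrr addr0.
rewrite (bigD1 l) //= eqxx mulr1 big1 ?addr0 // => j /negPf ne.
by rewrite eq_sym ne mulr0.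
Qed.

(** The points obtained from a transversal s by changing one entry form with s
    an affine basis of the cell: they span it, and the weights outside the graph
    of s are affine coordinates separating them. *)
Lemma dim_cellof T : staircase T -> meets_rows T -> Defs.dim (cellof T) = (#|T| - d)%N.
Proof.
move=> sT fT; have [s ss] := transversal_exists fT.
pose D := T :\: graph s.
have -> : (#|T| - d)%N = #|D|.
  by rewrite cardsD; move/setIidPr: ss => ->; rewrite card_graph.
pose V : 'M[R]_(#|D|, n) := \matrix_(i < #|D|)
  (delta_mx 0 (enum_val i).2 - delta_mx 0 (s (enum_val i).1)).
apply/eqP; rewrite eqn_leq; apply/andP; split.
  apply/bigmax_leqP => e /asboolP[p [cp]].
  rewrite /affinely_independent /row_free => /eqP <-.
  have /boolp.choice[w wP] i : exists w, weights T w /\ p i = colsum w.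
    by have [w ww eqp] := cp i; exists w.
  have -> : \matrix_(i < e) (p (lift ord0 i) - p ord0)
      = (\matrix_(i, l) (w (lift ord0 i) (enum_val l).1 (enum_val l).2
                         - w ord0 (enum_val l).1 (enum_val l).2)) *m V.
    apply/row_matrixP => i; rewrite rowK row_mul; apply/rowP => j.
    have [[ww1 ->] [ww0 ->]] := (wP (lift ord0 i), wP ord0).
    rewrite (colsum_shift s ww1) (colsum_shift s ww0) opprD addrACA subrr add0r.
    rewrite -sumrB big_enum_val summxE !mxE; apply: eq_bigr => l _.
    by rewrite -scalerBl !mxE.
  exact: leq_trans (mxrankM_maxr _ _) (rank_leq_row _).
pose x (l : 'I_#|D|) := set_row s (enum_val l).1 (enum_val l).2.
have sx l : graph (x l) \subset T.
  apply: set_row_sub => //; rewrite -surjective_pairing.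
  by have := enum_valP l; rewrite inE => /andP[].
have /boolp.choice[c cP] (l : 'I_#|D|) : exists c : 'rV[R]_n, exists b,
    forall w, weights T w ->
    w (enum_val l).1 (enum_val l).2 = dotp c (colsum w) + b.
  exact: affine_weight.
pose p (i : 'I_#|D|.+1) := expv R (transversal_mnm
  (if unlift ord0 i is Some l then x l else s)).
have ind_p : affinely_independent p.
  apply/row_freeP; exists (\matrix_(j, l) c l 0 j); apply/matrixP => i l.
  rewrite !mxE; have [b cb] := cP l.
  transitivity (dotp (c l) (p (lift ord0 i) - p ord0)).
    by rewrite /dotp; apply: eq_bigr => j _; rewrite !mxE mulrC.
  rewrite dotpBr /p liftK unlift_none -!colsum_indic.
  have -> (y z : R) : y - z = (y + b) - (z + b) by rewrite opprD addrACA subrr addr0.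
  rewrite -!cb; try exact: weights_indic.
  have := enum_valP l; rewrite inE => /andP[]; set q := enum_val l.
  rewrite inE => /negPf nq _; rewrite !mxE nq subr0 ffunE.
  have [eq_1|ne_1] := eqVneq q.1 (enum_val i).1.
    congr ((_ : bool)%:R); rewrite -(inj_eq enum_val_inj) -/q.
    by rewrite -pair_eqE /= eq_1 eqxx.
  rewrite nq; case: (i =P l) => // eq_il.
  by rewrite eq_il eqxx in ne_1.
have le_n : (#|D| < n.+1)%N.
  by rewrite ltnS; move: ind_p => /eqP <-; apply: rank_leq_col.
apply: (leq_bigmax_cond (Ordinal le_n)); apply/asboolP; exists p; split=> // i.
by apply: expv_transversal; case: unliftP.
Qed.

Lemma facet_cellof T F : staircase T -> meets_rows T ->
  facet (cellof T) F <->
  exists T', [/\ covers T T', meets_rows T' & F = cellof T'].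
Proof.
move=> sT fT; split=> [[ne0 /(face_cellof_inv fT)[F0|[T' [sub fT' ->]]]]|].
- by move: ne0; rewrite F0 => -[].
- rewrite !dim_cellof //; last exact: staircaseS sT.
  move=> eqd; exists T'; split=> //; rewrite /covers sub /=; apply/eqP.
  by rewrite -(subnK (meets_rows_card fT)) eqd addSn subnK ?meets_rows_card.
- move=> [T' [cov fT' ->]]; have /andP[sub /eqP card] := cov.
  split; [exact/cellof_nonempty|exact: face_cellof|].
  rewrite !dim_cellof //; last exact: staircaseS sT.
  by rewrite card subSn // meets_rows_card.
Qed.

End Cells.
Arguments cellof R {d n} T _.

(** * The cells of P_d *)

Section Polytopes.
Local Open Scope classical_set_scope.
Variables (R : realType) (N : nat).
Implicit Types (A : set 'rV[R]_N).

Lemma conv_fin A (J : finType) (p : J -> 'rV[R]_N) (c : J -> R) :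
  (forall j, A (p j)) -> (forall j, 0 <= c j) -> \sum_j c j = 1 ->
  conv A (\sum_j c j *: p j).
Proof.
move=> Ap c0 c1; exists #|J|, (fun i => p (enum_val i)), (fun i => c (enum_val i)).
have bij : {on [pred j | true], bijective (@enum_val J J)}.
  exact/onW_bij/enum_val_bij.
split=> //; last exact: reindex.
by rewrite -c1 [RHS](reindex _ bij).
Qed.

(** The products of the coefficients of two convex combinations are the
    coefficients of a convex combination of the pairwise sums. *)
Lemma conv_sum A B :
  [set x + y | x in conv A & y in conv B] = conv [set x + y | x in A & y in B].
Proof.
apply/seteqP; split=> [_ [_ [r [p [c [Ap c0 c1 ->]]]]
                        [_ [r' [q [e [Bq e0 e1 ->]]]] <-]]|z].
- have -> : \sum_i c i *: p i + \sum_j e j *: q j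
      = \sum_(l : 'I_r * 'I_r') (c l.1 * e l.2) *: (p l.1 + q l.2).
    rewrite -(pair_big xpredT xpredT (fun i j => (c i * e j) *: (p i + q j))) /=.
    transitivity (\sum_i c i *: (p i + \sum_j e j *: q j)).
      under [RHS]eq_bigr do rewrite scalerDr.
      by rewrite big_split /= -scaler_suml c1 scale1r.
    apply: eq_bigr => i _.
    have -> : p i + \sum_j e j *: q j = \sum_j e j *: (p i + q j).
      under [RHS]eq_bigr do rewrite scalerDr.
      by rewrite big_split /= -scaler_suml e1 scale1r.
    by rewrite scaler_sumr; apply: eq_bigr => j _; rewrite scalerA.
  apply: conv_fin => [l|l|]; first by exists (p l.1) => //; exists (q l.2).
    by rewrite mulr_ge0.
  rewrite -(pair_big xpredT xpredT (fun i j => c i * e j)) /= -c1.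
  by apply: eq_bigr => i _; rewrite -big_distrr /= e1 mulr1.
- move=> [r [p [c [/= ABp c0 c1 ->]]]].
  have /boolp.choice[u uP] i : exists u : 'rV[R]_N * 'rV[R]_N,
      [/\ A u.1, B u.2 & u.1 + u.2 = p i].
    by have [x Ax [y By eqp]] := ABp i; exists (x, y).
  exists (\sum_i c i *: (u i).1).
    by apply: conv_fin => // i; have [] := uP i.
  exists (\sum_i c i *: (u i).2).
    by apply: conv_fin => // i; have [] := uP i.
  rewrite -big_split; apply: eq_bigr => i _ /=.
  by rewrite -scalerDr; have [_ _ ->] := uP i.
Qed.

Lemma conv_set0 : conv set0 = set0 :> set 'rV[R]_N.
Proof.
apply/seteqP; split=> // x [[|r] [p [c [Ap c0 c1 _]]]]; last exact: (Ap ord0).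
by move/eqP: c1; rewrite big_ord0 eq_sym oner_eq0.
Qed.

Lemma polytope_sum (F G : set 'rV[R]_N) : polytope F -> polytope G ->
  polytope [set x + y | x in F & y in G].
Proof.
move=> [A [finA ->]] [B [finB ->]]; exists [set x + y | x in A & y in B].
split; last exact: conv_sum.
exact: finite_image2.
Qed.

Lemma polytope_set0 : polytope (set0 : set 'rV[R]_N).
Proof. by exists set0; rewrite conv_set0; split=> //; exact: finite_set0. Qed.

End Polytopes.

Section PdCells.
Local Open Scope classical_set_scope.
Variables (R : realType) (n : nat).

Definition simplex (A : {set 'I_n}) : set 'rV[R]_n :=
  [set x | [/\ forall j, 0 <= x 0 j, \sum_j x 0 j = 1
             & forall j, x 0 j != 0 -> j \in A]].

Lemma conv_delta (A : {set 'I_n}) :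
  conv [set delta_mx 0 i | i in [set` A]] = simplex A.
Proof.
apply/seteqP; split=> [x [r [p [c [Ap c0 c1 ->]]]]|x [x0 x1 xA]].
  have /boolp.choice[f fP] i : exists j, j \in A /\ delta_mx 0 j = p i.
    by have [j Aj eqp] := Ap i; exists j.
  have xE j : (\sum_i c i *: p i) 0 j = \sum_i c i * (j == f i)%:R.
    rewrite summxE; apply: eq_bigr => i _; have [_ <-] := fP i.
    by rewrite !mxE eqxx.
  split=> [j||j].
  - by rewrite xE sumr_ge0 // => i _; rewrite mulr_ge0 ?ler0n.
  - rewrite -c1; under eq_bigr do rewrite xE; rewrite exchange_big.
    apply: eq_bigr => i _ /=; rewrite -big_distrr /= (bigD1 (f i)) //= eqxx.
    by rewrite big1 ?addr0 ?mulr1 // => j /negPf ->.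
  - rewrite xE => ne0; apply/contraT => nAj; case/eqP: ne0; apply: big1 => i _.
    case: eqP => [eq_j|]; last by rewrite mulr0.
    by have [fA _] := fP i; rewrite eq_j fA in nAj.
have eqx : x = \sum_(i < #|A|) x 0 (enum_val i) *: delta_mx 0 (enum_val i).
  rewrite -(big_enum_val (fun j => x 0 j *: delta_mx 0 j)) /=.
  rewrite {1}[x]row_sum_delta [RHS]big_mkcond; apply: eq_bigr => j _.
  case: ifPn => // nA; have -> : x 0 j = 0; last by rewrite scale0r.
  by apply/eqP; apply: contraNT nA => /xA.
rewrite eqx; apply: conv_fin => [i|i|].
- by exists (enum_val i) => //=; exact: enum_valP.
- exact: x0.
- rewrite -(big_enum_val (fun j => x 0 j)) -x1 /= big_mkcond.
  apply: eq_bigr => j _; case: ifPn => // nA.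
  by apply/esym/eqP; apply: contraNT nA => /xA.
Qed.

(** With P_0 a point, P_1 also obeys the recursion: k = b gives all its cells. *)
Lemma Pd_rec d a b H : (a <= b)%N -> Pd R n d.+1 a b H <->
  exists k, (a <= k <= b)%N /\
    exists F G, [/\ Delta R n a k F, Pd R n d k b G
                  & H = [set x + y | x in F & y in G]].
Proof.
case: d => [|d] // le_ab; split=> [[A [ab ->]]|[k [/andP[ak kb]] [F [G [[A [aA ->]]]]]]].
  exists b; rewrite le_ab leqnn; split=> //.
  exists (conv [set delta_mx 0 i | i in [set` A]]), [set 0]; split.
  - by exists A.
  - by right.
  - apply/seteqP; split=> [x cx|_ [x cx [_ -> <-]]]; last by rewrite addr0.
    by exists x => //; exists 0 => //; rewrite addr0.
case=> -> ->.
  exists finset.set0; split=> [i|]; first by rewrite inE.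
  have -> : [set` (finset.set0 : {set 'I_n})] = set0.
    by apply/seteqP; split=> i //=; rewrite inE.
  rewrite image_set0 conv_set0.
  by apply/seteqP; split=> // _ [x _ [y []]].
exists A; split=> [i /aA/andP[-> ik]|]; first exact: leq_trans kb.
apply/seteqP; split=> [_ [x cx [_ -> <-]]|x cx]; first by rewrite addr0.
by exists x => //; exists 0 => //; rewrite addr0.
Qed.

Lemma Pd_polytope d a b F : (a <= b)%N -> Pd R n d a b F -> polytope F.
Proof.
elim: d a b F => [|d IHd] a b F le_ab.
  case=> ->; first exact: polytope_set0.
  exists [set 0]; split; first exact: finite_set1.
  apply/seteqP; split=> [_ ->|x [r [p [c [p0 _ _ ->]]]]].
    have := @conv_fin R n [set 0] _ (fun _ : unit => 0) (fun=> 1).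
    by rewrite !big_const card_unit /= !addr0 scale1r; apply.
  by apply: big1 => i _; rewrite p0 scaler0.
move=> /Pd_rec-/(_ le_ab)[k [/andP[_ kb] [F1 [G [[A [_ ->]] PG ->]]]]].
apply: polytope_sum (IHd _ _ _ kb PG).
exists [set delta_mx 0 i | i in [set` A]]; split=> //.
exact/finite_image/finite_finset.
Qed.

Definition cons_row d (A : {set 'I_n}) (T : {set 'I_d * 'I_n}) :
    {set 'I_d.+1 * 'I_n} :=
  [set p | if unlift ord0 p.1 is Some i then (i, p.2) \in T else p.2 \in A]%SET.

Lemma mem_cons_row0 d A (T : {set 'I_d * 'I_n}) j :
  ((ord0, j) \in cons_row A T) = (j \in A).
Proof. by rewrite inE /= unlift_none. Qed.

Lemma mem_cons_rowS d A (T : {set 'I_d * 'I_n}) i j :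
  ((lift ord0 i, j) \in cons_row A T) = ((i, j) \in T).
Proof. by rewrite inE /= liftK. Qed.

Lemma cons_row_exists d (T : {set 'I_d.+1 * 'I_n}) :
  exists A T', T = cons_row A T'.
Proof.
exists [set j | (ord0, j) \in T]%SET, [set p | (lift ord0 p.1, p.2) \in T]%SET.
apply/setP => -[i j]; rewrite inE /=.
by case: unliftP => [i'|] ->; rewrite inE.
Qed.

Lemma cellof_cons d A (T : {set 'I_d * 'I_n}) :
  cellof R (cons_row A T) = [set x + y | x in simplex A & y in cellof R T].
Proof.
apply/seteqP; split=> [_ [w [w0 w1 wT] ->]|_ [x [x0 x1 xA] [_ [w [w0 w1 wT] ->] <-]]].
  exists (row ord0 w).
    split=> [j||j]; rewrite ?mxE //; last by move=> /wT; rewrite mem_cons_row0.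
    by rewrite -(w1 ord0); apply: eq_bigr => j _; rewrite mxE.
  exists (colsum (\matrix_(i, j) w (lift ord0 i) j)).
    exists (\matrix_(i, j) w (lift ord0 i) j) => //; split=> [i j|i|i j].
    - by rewrite mxE.
    - by rewrite -(w1 (lift ord0 i)); apply: eq_bigr => j _; rewrite mxE.
    - by rewrite mxE => /wT; rewrite mem_cons_rowS.
  apply/rowP => j; rewrite !mxE big_ord_recl; congr (_ + _).
  by apply: eq_bigr => i _; rewrite mxE.
pose w' : 'M[R]_(d.+1, n) :=
  \matrix_(i, j) if unlift ord0 i is Some i' then w i' j else x 0 j.
have w'0 j : w' ord0 j = x 0 j by rewrite mxE unlift_none.
have w'S i j : w' (lift ord0 i) j = w i j by rewrite mxE liftK.
exists w'.
  split=> [i j|i|i j]; case: (unliftP ord0 i) => [i'|] ->.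
  - by rewrite w'S.
  - by rewrite w'0.
  - by under eq_bigr do rewrite w'S.
  - by under eq_bigr do rewrite w'0.
  - by rewrite w'S mem_cons_rowS => /wT.
  - by rewrite w'0 mem_cons_row0 => /xA.
apply/rowP => j; rewrite !mxE big_ord_recl w'0; congr (_ + _).
by apply: eq_bigr => i _; rewrite w'S.
Qed.

Lemma staircase_cons d A (T : {set 'I_d * 'I_n}) :
  staircase (cons_row A T) <->
  staircase T /\ forall j i j', j \in A -> (i, j') \in T -> (j <= j')%N.
Proof.
split=> [/staircaseP sT|[/staircaseP sT AT]].
  split=> [|j i j' Aj Tij'].
    apply/staircaseP => i j i' j' Tij Tij' lt_ii'.
    by apply: (sT (lift ord0 i) j (lift ord0 i') j'); rewrite ?mem_cons_rowS.
  by apply: (sT ord0 j (lift ord0 i) j'); rewrite ?mem_cons_rowS ?mem_cons_row0.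
apply/staircaseP => i j i' j'.
case: (unliftP ord0 i) => [i1|] ->; case: (unliftP ord0 i') => [i1'|] ->;
  rewrite ?mem_cons_rowS ?mem_cons_row0 //.
- by move=> Tij Tij' lt; apply: sT Tij Tij' lt.
- by move=> Aj Tij' _; apply: AT Tij'.
Qed.

Lemma meets_rows_cons d A (T : {set 'I_d * 'I_n}) :
  meets_rows (cons_row A T) -> (exists j, j \in A) /\ meets_rows T.
Proof.
move=> /meets_rowsP fT; split.
  by have [j] := fT ord0; rewrite mem_cons_row0; exists j.
apply/meets_rowsP => i; have [j] := fT (lift ord0 i).
by rewrite mem_cons_rowS; exists j.
Qed.

(** One step of the recursion adds a first row to the staircase; conversely, the
    largest element of the first row separates it from the other rows and serves
    as the index k. *)
Lemma Pd_cells d a b F : (a <= b)%N -> Pd R n d a b F <->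
  F = set0 \/ exists T : {set 'I_d * 'I_n},
    [/\ staircase T, meets_rows T,
        forall i j, (i, j) \in T -> (a <= j <= b)%N & F = cellof R T].
Proof.
elim: d a b F => [|d IHd] a b F le_ab.
  have cell0 (T : {set 'I_0 * 'I_n}) : cellof R T = [set 0].
    apply/seteqP; split=> [_ [w _ ->]|_ ->].
      by apply/rowP => j; rewrite !mxE big_ord0.
    exists 0; first by split=> -[].
    by apply/rowP => j; rewrite !mxE big_ord0.
  split=> [[->|->]|[->|[T [_ _ _ ->]]]]; [by left| |by left|by right].
  right; exists finset.set0; split; last by rewrite cell0.
  - by apply/staircaseP => -[].
  - by apply/meets_rowsP => -[].
  - by move=> [].
rewrite Pd_rec //; split.
- move=> [k [/andP[ak kb] [F1 [G [[A [aA ->]] /(IHd _ _ _ kb) PG ->]]]]].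
  rewrite conv_delta; case: PG => [->|[T [sT fT kT ->]]].
    by left; apply/seteqP; split=> // _ [x _ [y []]].
  rewrite -cellof_cons.
  have [f'T|nf'T] := boolP (meets_rows (cons_row A T)); last first.
    by left; apply: cellof_empty.
  right; exists (cons_row A T); split=> //.
  + apply/staircase_cons; split=> // j i j' /aA/andP[_ jk] /kT/andP[kj' _].
    exact: leq_trans kj'.
  + move=> i j; case: (unliftP ord0 i) => [i1|] ->.
      rewrite mem_cons_rowS => /kT/andP[kj ->]; rewrite andbT.
      exact: leq_trans kj.
    by rewrite mem_cons_row0 => /aA/andP[-> /leq_trans]; apply.
- case=> [->|[T [sT fT aT ->]]].
    exists a; rewrite leqnn le_ab; split=> //.
    exists (conv [set delta_mx 0 i | i in [set` (finset.set0 : {set 'I_n})]]), set0.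
    split; last by apply/seteqP; split=> // _ [x _ [y []]].
      by exists finset.set0; split=> // i; rewrite inE.
    by apply/IHd => //; left.
  have [A [T' eqT]] := cons_row_exists T; subst T.
  have [[j0 Aj0] fT'] := meets_rows_cons fT.
  have [sT' AT'] := (staircase_cons _ _).1 sT.
  pose k := [arg max_(j > j0 | j \in A) val j].
  have [Ak maxk] : k \in A /\ forall j, j \in A -> (j <= k)%N.
    by rewrite /k; case: arg_maxnP => // j Aj maxj; split.
  have abA j : j \in A -> (a <= j <= b)%N.
    by move=> Aj; apply: (aT ord0); rewrite mem_cons_row0.
  exists k; rewrite (abA _ Ak); split=> //.
  exists (conv [set delta_mx 0 i | i in [set` A]]), (cellof R T'); split.
  + exists A; split=> // j Aj; have /andP[-> _] := abA _ Aj.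
    exact: maxk.
  + have /andP[_ kb] := abA _ Ak; apply/(IHd _ _ _ kb); right; exists T'.
    split=> // i j T'ij; rewrite (AT' _ _ _ Ak T'ij) /=.
    have : (lift ord0 i, j) \in cons_row A T' by rewrite mem_cons_rowS.
    by move=> /aT/andP[].
  + by rewrite conv_delta cellof_cons.
Qed.

End PdCells.

(** * Signs *)

Section Signs.
Import fintype mathcomp.boot.finset.
Variables (d n : nat).
Implicit Types (T : {set 'I_d * 'I_n}) (p q : 'I_d * 'I_n).

Definition lex_lt p q := (p.1 < q.1)%N || (p.1 == q.1) && (p.2 < q.2)%N.

Definition rank_in T p := #|[set q in T | lex_lt q p]|.

(** The usual simplicial sign: a cell is a product of simplices, yet its facets
    arise by removing elements of T, as those of a simplex on T do. *)
Definition stair_sign T p : int := (-1) ^+ rank_in T p.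

Lemma lex_lt_total p q : p != q -> lex_lt p q || lex_lt q p.
Proof.
case: p q => [i j] [i' j']; rewrite xpair_eqE /lex_lt /= [i' == i]eq_sym.
have [lt_ii'|lt_i'i|/val_inj ->] := ltngtP i i'; rewrite ?orbT //.
by rewrite eqxx /= -neq_ltn.
Qed.

Lemma lex_lt_asym p q : lex_lt p q -> lex_lt q p = false.
Proof. by rewrite /lex_lt -!val_eqE /=; lia. Qed.

Lemma rank_in_lt T p q : p \in T -> lex_lt p q ->
  rank_in T q = (rank_in (T :\ p) q).+1 /\ rank_in (T :\ q) p = rank_in T p.
Proof.
move=> pT lt_pq; split.
  rewrite /rank_in (cardsD1 p) !inE pT lt_pq; congr (_.+1).
  by apply: eq_card => r; rewrite !inE andbA.
apply: eq_card => r; rewrite !inE; have [->|//] := eqVneq r q.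
by rewrite lex_lt_asym // !andbF.
Qed.

Lemma stair_sign_unit T p : stair_sign T p = 1 \/ stair_sign T p = -1.
Proof.
by rewrite /stair_sign -signr_odd; case: odd; [right|left].
Qed.

Lemma stair_sign_diamond T p q : p \in T -> q \in T -> p != q ->
  stair_sign T p * stair_sign (T :\ p) q
    + stair_sign T q * stair_sign (T :\ q) p = 0.
Proof.
suff lt_case (a b : 'I_d * 'I_n) : a \in T -> lex_lt a b ->
    stair_sign T a * stair_sign (T :\ a) b
    + stair_sign T b * stair_sign (T :\ b) a = 0.
  move=> pT qT /lex_lt_total/orP[lt_pq|lt_qp]; first exact: lt_case.
  by rewrite addrC; apply: lt_case.
move=> aT lt_ab; have [eq_b eq_a] := rank_in_lt aT lt_ab.
by rewrite /stair_sign eq_b eq_a exprS mulN1r mulNr [X in _ - X]mulrC subrr.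
Qed.

Lemma stair_sign_edge T p q : p \in T -> q \in T -> p != q ->
    #|T| = d.+1 -> meets_rows (T :\ p) -> meets_rows (T :\ q) ->
  stair_sign T p + stair_sign T q = 0.
Proof.
suff lt_case (a b : 'I_d * 'I_n) : a \in T -> b \in T -> lex_lt a b ->
    #|T| = d.+1 -> meets_rows (T :\ a) -> meets_rows (T :\ b) ->
    stair_sign T a + stair_sign T b = 0.
  move=> pT qT /lex_lt_total/orP[lt_pq|lt_qp] cT fp fq; first exact: lt_case.
  by rewrite addrC; apply: lt_case.
move=> aT bT lt_ab cT fa fb.
have [s eq_s] : exists s, T :\ a = graph s.
  by apply: meets_rows_card_eq fa _; move: cT; rewrite (cardsD1 a) aT => -[].
have ne_ba : b != a.
  by apply: contraTneq lt_ab => ->; rewrite /lex_lt !ltnn andbF.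
have sE r : r \in T -> r != a -> s r.1 = r.2.
  move=> rT ne; apply/eqP; have : r \in T :\ a by rewrite !inE ne.
  by rewrite eq_s inE.
(* T :\ a is a graph, so a, whose removal leaves every row met, shares its row
   with a single other element; since T :\ b meets all rows, that one is b. *)
have eq_1 : a.1 = b.1.
  apply/eqP; apply: contraT => ne_1; case: b => i j in bT lt_ab fb ne_ba ne_1 *.
  have [j' Tij' ne_j] := meets_rowsD1_ex fb.
  have ne' (l : 'I_n) : (i, l) != a by apply: contraNneq ne_1 => <-.
  have := sE _ Tij' (ne' _); have /= -> := sE _ bT (ne' _).
  by move=> eq_j; rewrite eq_j eqxx in ne_j.
have eq_rank : rank_in T b = (rank_in T a).+1.
  have [-> _] := rank_in_lt aT lt_ab; congr (_.+1); apply: eq_card => r.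
  rewrite !inE; have [->|ne_ra] := eqVneq r a.
    by rewrite /= [X in _ = _ && X]/lex_lt !ltnn !andbF.
  have [rT|] //= := boolP (r \in T); rewrite /lex_lt eq_1.
  have [eq_r1|//] := eqVneq r.1 b.1; rewrite eq_r1 ltnn /=.
  have eq_rb : r = b.
    by rewrite [r]surjective_pairing [b]surjective_pairing -(sE r) // -(sE b) // eq_r1.
  by move: lt_ab; rewrite eq_rb ltnn /lex_lt eq_1 ltnn eqxx /= => /ltnW; rewrite leqNgt => /negPf ->.
rewrite /stair_sign eq_rank exprS mulN1r.
exact: subrr.
Qed.

Definition stair_eps T T' : int :=
  if covers T T' then \sum_(p in T :\: T') stair_sign T p else 0.

Lemma stair_epsE T p : p \in T -> stair_eps T (T :\ p) = stair_sign T p.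
Proof.
move=> pT; rewrite /stair_eps; have -> : covers T (T :\ p) by apply/coversP; exists p.
have -> : T :\: (T :\ p) = [set p]; last by rewrite big_set1.
by rewrite setDDr setDv set0U; apply/setIidPr; rewrite sub1set.
Qed.

End Signs.

(** * The cells with all vertices in a Borel closed set *)

Section Assembly.
Import fintype mathcomp.boot.finset.
Variables (R : realType) (k : fieldType) (d n : nat) (B : set 'X_{1..n}).
Hypothesis B_deg : forall m, B m -> mdeg m = d.
Hypothesis B_closed : borel_closed B.
Implicit Types (T : {set 'I_d * 'I_n}).

Let I := monomials_ideal k B.

Definition label (v : 'rV[R]_n) : 'X_{1..n} :=
  xget 0%MM [set m | expv R m = v]%classic.

Lemma label_expv m : label (expv R m) = m.
Proof.
rewrite /label; case: xgetP => [m' -> /= eq_m|/(_ m)[]//].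
apply/mnmP => i; apply/eqP; rewrite -(eqr_nat R).
by have /rowP/(_ i) := eq_m; rewrite !mxE => ->.
Qed.

(** The empty face is added separately: a family missing a row has an empty
    cell, but for d = 0 there are no rows and the only cell is the origin. *)
Definition subcomplex : {fset set 'rV[R]_n} :=
  fset_set (classical_sets.setU [set classical_sets.set0]
              [set cellof R T | T in [set T : {set 'I_d * 'I_n} | inB_cell B T]]%classic)%classic.

Lemma subcomplexP F : F \in subcomplex <->
  F = classical_sets.set0 \/ exists T, inB_cell B T /\ F = cellof R T.
Proof.
rewrite /subcomplex in_fset_set; last first.
  rewrite finite_setU; split; first exact: finite_set1.
  exact/finite_image/finite_finset.
rewrite in_setE; split=> [[->|[T BT <-]]|[->|[T [BT ->]]]]; [by left| |by left|].
  by right; exists T.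
by right; exists T.
Qed.

Lemma set0_in_subcomplex : classical_sets.set0 \in subcomplex.
Proof. by apply/subcomplexP; left. Qed.

Lemma cellof_in_subcomplex T : inB_cell B T -> cellof R T \in subcomplex.
Proof. by move=> BT; apply/subcomplexP; right; exists T. Qed.

Lemma face_of_set0 (F : set 'rV[R]_n) :
  face classical_sets.set0 F -> F = classical_sets.set0.
Proof. by move=> [c [b [_ ->]]]; apply/seteqP; split=> // x []. Qed.

Lemma face_set0 (P : set 'rV[R]_n) : face P classical_sets.set0.
Proof.
exists 0, 1; split=> [x _|]; first by rewrite dotp0l ler01.
apply/seteqP; split=> // x [_]; rewrite dotp0l => /eqP.
by rewrite eq_sym oner_eq0.
Qed.

Lemma Pd_cell T : staircase T -> meets_rows T -> Pd R n d 0 n.-1 (cellof R T).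
Proof.
move=> sT fT; apply/Pd_cells => //; right; exists T; split=> // i j _.
by have := ltn_ord j; lia.
Qed.

Lemma subcomplex_polyhedral : polyhedral_complex subcomplex.
Proof.
split.
- by apply/fset0Pn; exists classical_sets.set0; exact: set0_in_subcomplex.
- move=> _ /subcomplexP[->|[T [[sT fT _] ->]]]; first exact: polytope_set0.
  exact: Pd_polytope (Pd_cell sT fT).
- move=> _ F /subcomplexP[->|[T [BT ->]]].
    by move=> /face_of_set0 ->; exact: set0_in_subcomplex.
  have [sT fT _] := BT => /(face_cellof_inv fT)[->|[T' [sub fT' ->]]].
    exact: set0_in_subcomplex.
  exact/cellof_in_subcomplex/(inB_cellS BT).
- move=> _ _ /subcomplexP[->|[T [[sT _ _] ->]]] /subcomplexP[->|[T' [[sT' _ _] ->]]];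
    rewrite ?classical_sets.set0I ?classical_sets.setI0; try by split; exact: face_set0.
  rewrite cellofI //; split; apply: face_cellof => //.
    exact: subsetIl.
  exact: subsetIr.
Qed.

Lemma inB_transversal (s : {ffun 'I_d -> 'I_n}) :
  I 'X_[transversal_mnm s] -> B (transversal_mnm s).
Proof.
move=> /monomials_idealX[u Bu le_u].
by rewrite -(lepm_mdeg_eq le_u) // mdeg_transversal_mnm B_deg.
Qed.

Lemma subcomplex_Pd F : F \in subcomplex <->
  Pd R n d 0 n.-1 F /\ forall v, vertices F v -> I 'X_[label v].
Proof.
rewrite subcomplexP; split=> [[->|[T [[sT fT BT] ->]]]|].
- split=> [|v /face_of_set0 eqv]; first by apply/Pd_cells => //; left.
  by have : classical_sets.set0 v by rewrite -eqv.
- split=> [|v /(cellof_vertices v sT fT)[s ss ->]]; first exact: Pd_cell.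
  rewrite label_expv; apply/monomials_idealX; exists (transversal_mnm s).
    exact: BT.
  exact: lepm_refl.
- move=> [/Pd_cells-/(_ (leq0n _))[->|[T [sT fT _ ->]]] vI]; first by left.
  right; exists T; split=> //; split=> // s ss; apply: inB_transversal.
  rewrite -(label_expv (transversal_mnm s)); apply: vI.
  by apply/(cellof_vertices _ sT fT); exists s.
Qed.

Lemma subcomplex_vertices :
  set_bij (complex_vertices subcomplex) (min_gens I) label.
Proof.
rewrite /I (min_gens_eqdeg _ B_deg).
have vertexP v : complex_vertices subcomplex v <-> exists2 m, B m & v = expv R m.
  rewrite /complex_vertices /= subcomplexP; split=> [[eqv|[T [BT eqv]]]|[m Bm ->]].
  - by have : classical_sets.set0 v by rewrite -eqv.
  - have [_ fT BT'] := BT; have [s ss] := transversal_exists fT.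
    exists (transversal_mnm s); first exact: BT'.
    have : [set v]%classic (expv R (transversal_mnm s)).
      by rewrite eqv; apply: expv_transversal.
    by move=> ->.
  - have [s Bs <-] := greedy_cell Bm (B_deg Bm).
    by right; exists (graph s); rewrite cellof_graph.
split=> [v /vertexP[m Bm ->]|v v'|m Bm] /=.
- by rewrite label_expv.
- rewrite !in_setE => /vertexP[m _ ->] /vertexP[m' _ ->].
  by rewrite !label_expv => ->.
- by exists (expv R m); rewrite ?label_expv //; apply/vertexP; exists m.
Qed.

(** The exponent of variable j is reached by the transversal choosing j in every
    row that allows it. *)
Lemma label_cellof T : staircase T -> meets_rows T ->
  face_label label (cellof R T) = cell_mnm T.
Proof.
move=> sT fT; have finV : finite_set (vertices (cellof R T)).
  apply: (@sub_finite_set _ _ [set expv R (transversal_mnm s) | s in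
    [set: {ffun 'I_d -> 'I_n}]]%classic).
    by move=> v /(cellof_vertices v sT fT)[s _ ->]; exists s.
  exact/finite_image/finite_finset.
apply/mnmP => j; rewrite /face_label.
have -> : forall r : seq 'rV[R]_n, (\big[@mlcm n/0%MM]_(v <- r) label v) j
    = \max_(v <- r) label v j.
  elim=> [|v r IHr]; first by rewrite !big_nil mnm0E.
  by rewrite !big_cons -IHr mnmE.
have memV s : graph s \subset T ->
    expv R (transversal_mnm s) \in fset_set (vertices (cellof R T)).
  move=> ss; rewrite in_fset_set // in_setE.
  by apply/(cellof_vertices _ sT fT); exists s.
apply/eqP; rewrite eqn_leq; apply/andP; split.
  apply/bigmax_leqP_seq => v; rewrite in_fset_set // in_setE => + _.
  move=> /(cellof_vertices v sT fT)[s ss ->].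
  rewrite label_expv -cell_mnm_graph.
  by have /mnm_lepP := cell_mnmS ss; apply.
have [s0 /graphP ss0] := transversal_exists fT.
pose s := [ffun i => if (i, j) \in T then j else s0 i].
have ss : graph s \subset T by apply/graphP => i; rewrite ffunE; case: ifP.
have le_s : (cell_mnm T j <= label (expv R (transversal_mnm s)) j)%N.
  rewrite label_expv -cell_mnm_graph !cell_mnmE subset_leq_card //.
  apply/subsetP => -[i j']; rewrite !inE /= => /andP[Tij /eqP eq_j].
  by rewrite ffunE -eq_j Tij eqxx.
exact: leq_trans le_s (leq_bigmax_seq _ (memV s ss) _).
Qed.

(** ** Incidences *)

Definition stair_of (F : set 'rV[R]_n) : {set 'I_d * 'I_n} :=
  xget set0 [set T | [/\ staircase T, meets_rows T & cellof R T = F]]%classic.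

Lemma stair_ofE T : staircase T -> meets_rows T -> stair_of (cellof R T) = T.
Proof.
move=> sT fT; rewrite /stair_of; case: xgetP => [T' -> [sT' fT' eqT]|/(_ T)[]//].
exact: cellof_inj eqT.
Qed.

Lemma nonempty_cell F : F \in subcomplex -> (F !=set0)%classic ->
  inB_cell B (stair_of F) /\ cellof R (stair_of F) = F.
Proof.
move=> /subcomplexP[->[]//|[T [BT ->]]] _; have [sT fT _] := BT.
by rewrite stair_ofE.
Qed.

Lemma facet_stair F F' : F \in subcomplex -> facet F F' ->
  [/\ inB_cell B (stair_of F), cellof R (stair_of F) = F,
      inB_cell B (stair_of F'), cellof R (stair_of F') = F'
    & covers (stair_of F) (stair_of F')].
Proof.
move=> QF facF; have [ne0 faceF _] := facF.
have neF : (F !=set0)%classic.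
  case: ne0 => x; case: faceF => c [b [_ ->]] [Fx _]; by exists x.
have [BT eqF] := nonempty_cell QF neF; have [sT fT _] := BT.
move: facF; rewrite -{1}eqF => /(facet_cellof F' sT fT)[T' [cov fT' ->]].
have sub : T' \subset stair_of F by case/andP: cov.
rewrite !stair_ofE //; last exact: staircaseS sT.
by split=> //; apply: inB_cellS BT sub fT'.
Qed.

Lemma facet_cell_covers T T' : inB_cell B T -> inB_cell B T' -> covers T T' ->
  facet (cellof R T) (cellof R T').
Proof. by move=> [sT fT _] [_ fT' _] cov; apply/facet_cellof => //; exists T'. Qed.

Lemma card_vertex_cell T v : inB_cell B T -> cellof R T = [set v]%classic -> #|T| = d.
Proof.
move=> [sT fT _] eqv; have [s ss] := transversal_exists fT.
suff -> : T = graph s by rewrite card_graph.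
apply/esym/(cellof_inj (R := R)) => //; rewrite ?meets_rows_graph //.
  exact: staircaseS sT.
rewrite cellof_graph eqv; congr [set _]%classic.
have : [set v]%classic (expv R (transversal_mnm s)).
  by rewrite -eqv; apply: expv_transversal.
by [].
Qed.

Lemma incidence_exists : exists eps, incidence_function subcomplex eps.
Proof.
exists (fun F F' => stair_eps (stair_of F) (stair_of F')); split.
- move=> F F' QF _ /(facet_stair QF)[_ _ _ _ /coversP[p pT ->]].
  by rewrite stair_epsE //; exact: stair_sign_unit.
- move=> F F' QF QF' neF neF' nfac; rewrite /stair_eps; case: ifP => // cov.
  case: nfac; have [BT <-] := nonempty_cell QF neF.
  by have [BT' <-] := nonempty_cell QF' neF'; exact: facet_cell_covers.
- move=> F v w QF facv facw ne_vw.
  have [_ _ Bv eqv covv] := facet_stair QF facv.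
  have [_ _ Bw eqw covw] := facet_stair QF facw.
  have cardF : #|stair_of F| = d.+1.
    by have /andP[_ /eqP ->] := covv; rewrite (card_vertex_cell Bv eqv).
  have [p pF eq_p] := coversP _ _ covv; have [q qF eq_q] := coversP _ _ covw.
  rewrite eq_p eq_q !stair_epsE //; apply: stair_sign_edge => //.
  + apply: contra_notT ne_vw; rewrite negbK => /eqP eq_pq.
    have : [set v]%classic w by rewrite -eqv eq_p eq_pq -eq_q eqw.
    by move=> ->.
  + by rewrite -eq_p; case: Bv.
  + by rewrite -eq_q; case: Bw.
- move=> F F1 F2 F' QF ne12 fac1 fac1' fac2 fac2'.
  have [BF eqF B1 eq1 cov1] := facet_stair QF fac1.
  have [_ _ B2 eq2 cov2] := facet_stair QF fac2.
  have Q1 : F1 \in subcomplex by rewrite -eq1; exact: cellof_in_subcomplex.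
  have Q2 : F2 \in subcomplex by rewrite -eq2; exact: cellof_in_subcomplex.
  have [_ _ _ _ cov1'] := facet_stair Q1 fac1'.
  have [_ _ _ _ cov2'] := facet_stair Q2 fac2'.
  have [p pF eq_p] := coversP _ _ cov1; have [q qF eq_q] := coversP _ _ cov2.
  have ne_pq : p != q.
    by apply: contra_notN ne12 => /eqP eq_pq; rewrite -eq1 -eq2 eq_p eq_q eq_pq.
  have [p' p'1 eq_p'] := coversP _ _ cov1'; have [q' q'2 eq_q'] := coversP _ _ cov2'.
  have eq_pq' : p' = q /\ q' = p.
    have nq : q \notin stair_of F' by rewrite eq_q' eq_q !inE eqxx andbF.
    have np : p \notin stair_of F' by rewrite eq_p' eq_p !inE eqxx andbF.
    split; apply/esym/eqP.
      move: nq; rewrite eq_p' eq_p !inE qF [q == p]eq_sym (negPf ne_pq) !andbT.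
      by rewrite negbK.
    by move: np; rewrite eq_q' eq_q !inE pF (negPf ne_pq) !andbT negbK.
  case: eq_pq' => eq1' eq2'; subst p' q'.
  rewrite {1}eq_p' {1}eq_q' eq_p eq_q !stair_epsE //.
  + exact: stair_sign_diamond.
  + by rewrite -eq_q.
  + by rewrite -eq_p.
Qed.

(** Reading each cell as its staircase turns the cellular complex into the
    complex of staircases. *)
Lemma subcomplex_resolution eps : incidence_function subcomplex eps ->
  free_resolution (cellular_complex k subcomplex label eps) I /\
  minimal_complex (cellular_complex k subcomplex label eps).
Proof.
move=> [eps1 eps0 eps_e eps_d].
pose C := cell subcomplex; pose T (b : C) := stair_of (cell_set b).
have Q b : @cell_set R n subcomplex b \in subcomplex by exact: (valP (val b)).
have ne0 b : (@cell_set R n subcomplex b !=set0)%classic.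
  by apply/classical_sets.set0P; exact: (valP b).
have TB (b : C) : inB_cell B (T b) by case: (nonempty_cell (Q b) (ne0 b)).
have TE (b : C) : cellof R (T b) = cell_set b.
  by case: (nonempty_cell (Q b) (ne0 b)).
have Tfacet (b b' : C) : covers (T b) (T b') <-> facet (cell_set b) (cell_set b').
  split=> [|/(facet_stair (Q b))[]//].
  by rewrite -(TE b) -(TE b'); exact: facet_cell_covers.
have T_inj : injective T.
  move=> b b' eqT; apply: val_inj; apply: val_inj.
  by rewrite -[LHS]/(cell_set b) -[RHS]/(cell_set b') -(TE b) -(TE b') eqT.
have T_onto S : inB_cell B S -> exists b, T b = S.
  move=> BS; have [sS fS _] := BS.
  have neS : cellof R S != classical_sets.set0.
    by apply/classical_sets.set0P/cellof_nonempty.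
  exists (exist _ (FSetSub (cellof_in_subcomplex BS)) neS).
  by rewrite /T /cell_set /= stair_ofE.
have -> : cellular_complex k subcomplex label eps
    = staircase_complex k T (fun b b' : C => eps (cell_set b) (cell_set b')).
  have labE (b : C) : face_label label (cell_set b) = cell_mnm (T b).
    by have [sT fT _] := TB b; rewrite -(TE b) label_cellof // stair_ofE.
  rewrite /cellular_complex /staircase_complex; congr FreeComplex.
  - apply/funext => b; have [sT fT _] := TB b.
    by rewrite -{1}(TE b) dim_cellof.
  - by apply/funext => b; exact: labE.
  - by apply/funext => b; apply/funext => b'; rewrite !labE.
have epsE1 (b b' : C) : covers (T b) (T b') ->
    eps (cell_set b) (cell_set b') = 1 \/ eps (cell_set b) (cell_set b') = -1.
  by move=> /Tfacet fac; apply: eps1.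
have epsE0 (b b' : C) : ~~ covers (T b) (T b') ->
    eps (cell_set b) (cell_set b') = 0.
  by move=> /negP ncov; apply: eps0 => // /Tfacet.
split; last exact: staircase_minimal.
apply: staircase_resolution => //.
- move=> b v w cv cw /Tfacet fv /Tfacet fw ne_vw.
  have vertexE (u : C) : #|T u| = d -> exists x, cell_set u = [set x]%classic.
    move=> cu; have [_ fu _] := TB u; have [s eq_s] := meets_rows_card_eq fu cu.
    by exists (expv R (transversal_mnm s)); rewrite -(TE u) eq_s cellof_graph.
  have [x eqx] := vertexE v cv; have [y eqy] := vertexE w cw.
  rewrite eqx eqy in fv fw *; apply: eps_e => // eqxy.
  apply: ne_vw; apply: T_inj.
  by rewrite /T eqx eqy eqxy.
- move=> b b1 b2 b' ne /Tfacet f1 /Tfacet f1' /Tfacet f2 /Tfacet f2'.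
  apply: eps_d => // eq12; apply: ne; apply: T_inj.
  by rewrite /T eq12.
Qed.

End Assembly.

Local Open Scope classical_set_scope.

Theorem theorem3p19 (R : realType) (k : fieldType) (n d s : nat)
    (ms : 'I_s -> 'X_{1..n})
    (k_char0 : [pchar k] =i pred0)
    (ms_deg : forall i, mdeg (ms i) = d)
    (ms_rlex : forall i j : 'I_s, (i < j)%N -> rlex_gt (ms i) (ms j))
    (ms_min : minimal_borel_generators k ms) :
  exists (Q : {fset set 'rV[R]_n}) (lab : 'rV[R]_n -> 'X_{1..n}),
    [/\ forall m : 'X_{1..n}, lab (expv R m) = m,
        polyhedral_complex Q,
        supports_minimal_free_resolution Q lab (borel_ideal k (range ms))
      & forall F : set 'rV[R]_n,
          F \in Q <->
          Pd R n d 0 n.-1 F /\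
          forall v, vertices F v -> borel_ideal k (range ms) 'X_[lab v]].
Proof.
have B_closed := @borel_closure_closed n (range ms).
have B_deg : forall m, borel_closure (range ms) m -> mdeg m = d.
  by apply: borel_closure_mdeg => _ [i _ <-].
rewrite borel_ideal_closure.
exists (subcomplex R d (borel_closure (range ms))), (@label R n); split.
- exact: label_expv.
- exact: subcomplex_polyhedral.
- split.
  + exact: subcomplex_vertices.
  + exact: incidence_exists.
  + by move=> eps; exact: subcomplex_resolution.
- exact: subcomplex_Pd.
Qed.
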